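(* Let $q$ be a prime power, $m$ a non-negative integer and let $\mathcal{L}=\langle x^{q^{\ell_1}},\ldots,x^{q^{\ell_s}}\rangle\subset\mathbb{F}_{q^m}[x]$ be the $\mathbb{F}_{q^m}$-linear span of the indicated monomials, where $1\le \ell_1<\ell_2<\cdots<\ell_s<\frac m2$. If $\mathcal{L}$ is an even rank family, then the cyclic codes $\mathcal{C}_{\mathcal{L}}$ and $\mathcal{C}_{\mathcal{L},0}$ have dimensions $ms$ and $ms+1$ over $\mathbb{F}_q$, respectively, and their weight distributions are as follows (frequencies attached to coinciding weights are to be added). (1) $\mathcal{C}_{\mathcal{L}}$: weight $0$ with frequency $1$; and, for each $r\in R_{\mathcal{L}}$ and $i\in\{1,2\}$, weight $q^m-q^{m-1}+(-1)^i(q-1)q^{m-\frac r2-1}$ with frequency $M_{r,i}$. (2) $\mathcal{C}_{\mathcal{L},0}$: weight $0$ with frequency $1$; weight $q^m-1$ with frequency $q-1$; and, for each $r\in R_{\mathcal{L}}$ and $i\in\{1,2\}$, weight $q^m-q^{m-1}+(-1)^i(q-1)q^{m-\frac r2-1}$ with frequency $M_{r,i}$, and weight $q^m-q^{m-1}+(-1)^{i+1}q^{m-\frac r2-1}-1$ with frequency $M_{r,i}(q-1)$.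
   Context: A function $Q:\mathbb{F}_{q^m}\to\mathbb{F}_q$ is a quadratic form if, after identifying $\mathbb{F}_{q^m}\simeq\mathbb{F}_q^m$ as $\mathbb{F}_q$-spaces, it is given by a homogeneous polynomial of degree 2 in $m$ variables over $\mathbb{F}_q$. Its rank $r$ is the minimum number of variables needed to represent $Q$ (up to invertible linear change of variables); equivalently the codimension of $\{y: Q(y)=0,\ Q(x+y)=Q(x)\ \forall x\in\mathbb{F}_{q^m}\}$. If $r$ is even, then $\#\{x:Q(x)=0\}=q^{m-1}+\varepsilon_Q(q-1)q^{m-\frac r2-1}$ for a unique sign $\varepsilon_Q\in\{\pm1\}$; $Q$ is of type 1 if $\varepsilon_Q=+1$ and of type 3 if $\varepsilon_Q=-1$. $\mathrm{Tr}_{q^m/q}$ is the trace from $\mathbb{F}_{q^m}$ to $\mathbb{F}_q$. For $R\in\mathcal{L}$ put $Q_R(x)=\mathrm{Tr}_{q^m/q}(xR(x))$. $\mathcal{L}$ is an even rank family if $Q_R$ has even rank for every $R\in\mathcal{L}$. For $r\ge 0$ let $M_{r,1}$ (resp. $M_{r,2}$) be the number of $R\in\mathcal{L}\smallsetminus\{0\}$ such that $Q_R$ has rank $r$ and is of type 1 (resp. type 3), and let $R_{\mathcal{L}}=\{r: \exists R\in\mathcal{L}\text{ with }Q_R\text{ of rank }r\}$. The codes, of length $q^m-1$ over $\mathbb{F}_q$ (coordinates indexed by $\mathbb{F}_{q^m}^*$, ordered by powers of a primitive element), are $\mathcal{C}_{\mathcal{L}}=\{(\mathrm{Tr}_{q^m/q}(xR(x)))_{x\in\mathbb{F}_{q^m}^*}: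 R\in\mathcal{L}\}$ and $\mathcal{C}_{\mathcal{L},0}=\{(\mathrm{Tr}_{q^m/q}(xR(x))+b)_{x\in\mathbb{F}_{q^m}^*}: R\in\mathcal{L},\ b\in\mathbb{F}_q\}$. The weight of a codeword is its number of nonzero coordinates; the frequency of a weight is the number of codewords with that weight. *)

(* Defs.v *)
From HB Require Import structures.
From mathcomp Require Import all_boot all_order all_algebra all_field.
From mathcomp Require Import boolp finmap mpoly.

Set Implicit Arguments.
Unset Strict Implicit.
Unset Printing Implicit Defensive.

Import Order.TTheory GRing.Theory Num.Theory.
Local Open Scope ring_scope.

(* Throughout, F is the field with q = #|F| elements and L is an extension of
   F of degree m = \dim {:L}, so that L is F_{q^m}; [finvect_type L] is the
   library's alias of L equipped with its (non-canonical) finite structure.  *)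

Section QuadraticForms.

Variables (F : finFieldType) (L : fieldExtType F).
Implicit Type Q : L -> F.

Local Notation q := #|F|.
Local Notation m := (\dim {:L}).

Definition coords (x : L) : 'rV[F]_m := passmx.rVof (vbasis {:L}) x.

(* After the invertible change of variables P, the function Q is given by a
   homogeneous polynomial of degree 2 involving only the first r variables.  *)
Definition representable Q (r : nat) : Prop :=
  exists (P : 'M[F]_m) (p : {mpoly F[m]}),
    [/\ P \in unitmx,
        p \is 2.-homog,
        (forall mon, mon \in msupp p -> forall i : 'I_m, mon i != 0%N -> (i < r)%N)
      & forall x, Q x = p.@[fun i => (coords x *m P) 0 i]].

(* The least r <= m such that Q is representable in r variables; Q is a
   quadratic form iff it is representable in m variables, and the value m.+1
   is only taken at functions that are not quadratic forms.                  *)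
Definition qrank Q : nat :=
  find (fun r => `[< representable Q r >]) (iota 0 m.+1).

Definition zeros Q : {set finvect_type L} := [set x : finvect_type L | Q x == 0].

(* No truncation occurs in m - r/2 - 1: an even r <= m satisfies
   r/2 + 1 <= m since 0 < m.                                                 *)
Definition has_sign (eps : int) Q : bool :=
  ~~ odd (qrank Q) &&
  (#|zeros Q|%:Z ==
   (q ^ (m - 1))%N%:Z
     + eps * (q%:Z - 1) * (q ^ (m - (qrank Q)./2 - 1))%N%:Z).

Definition type1 Q := has_sign 1 Q.
Definition type3 Q := has_sign (-1) Q.

End QuadraticForms.

Section Families.

Variables (F : finFieldType) (L : splittingFieldType F).

Local Notation q := #|F|.
Local Notation m := (\dim {:L}).

(* [galTrace 1 {:L} x] is an element of L lying in the line F.1; its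
   coordinate on the basis 1 is the trace as an element of F.                *)
Definition Tr (x : L) : F :=
  coord [tuple (1 : L)] 0 (galTrace 1%AS {:L}%AS x).

Definition lin_poly (s : nat) (ell : 'I_s -> nat) 
    (a : {ffun 'I_s -> finvect_type L}) : {poly L} :=
  \sum_(i < s) (a i : L) *: 'X^(q ^ ell i).

Definition lin_family (s : nat) (ell : 'I_s -> nat) : {fset {poly L}} :=
  [fset lin_poly ell a | a in {ffun 'I_s -> finvect_type L}]%fset.

Definition qform (R : {poly L}) : L -> F := fun x => Tr (x * R.[x]).

Definition even_rank_family (fam : {fset {poly L}}) : Prop :=
  forall R, R \in fam -> ~~ odd (qrank (qform R)).

Definition ranks (fam : {fset {poly L}}) : {fset nat} :=
  [fset qrank (qform R) | R in fam]%fset.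

(* M_{r,i} for i = 1, 2. *)
Definition Mnum (fam : {fset {poly L}}) (r i : nat) : nat :=
  #|` [fset R in fam | [&& R != 0, qrank (qform R) == r
        & if i == 1%N then type1 (qform R) else type3 (qform R)]]%fset |.

(* The coordinates are indexed by L^*, the j-th one being alpha ^ j, where
   alpha is meant to be a primitive element.                                 *)
Local Notation n := (q ^ m - 1)%N.

Definition codeword (alpha : L) (R : {poly L}) (b : F) : 'rV[F]_n :=
  \row_(j < n) (qform R (alpha ^+ j) + b).

Definition code (alpha : L) (fam : {fset {poly L}}) : {fset 'rV[F]_n} :=
  [fset codeword alpha R 0 | R in fam]%fset.

Definition code0 (alpha : L) (fam : {fset {poly L}}) : {fset 'rV[F]_n} :=
  [fset codeword alpha R b | R in fam, b in F]%fset.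

End Families.

Arguments lin_family {F} L {s} ell.

Section Codes.

Variables (F : finFieldType) (n : nat).
Implicit Type C : {fset 'rV[F]_n}.

Definition has_dimension C (k : nat) : Prop :=
  exists2 V : {vspace 'rV[F]_n}, (forall c, (c \in V) = (c \in C)) & \dim V = k.

Definition cyclic_code C : Prop :=
  forall c, c \in C -> \row_j c 0 (ordS j) \in C.

Definition wt (c : 'rV[F]_n) : nat := #|[set j | c 0 j != 0]|.

(* A table lists pairs (weight, frequency); the frequencies attached to
   coinciding weights are added, and any w not in the table has frequency 0. *)
Definition weight_distribution C (table : seq (int * nat)) : Prop :=
  forall w : int,
    #|` [fset c in C | (wt c)%:Z == w]%fset | = (\sum_(t <- table | t.1 == w) t.2)%N.

End Codes.

(* Main.v *)
Require Import Defs.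
From HB Require Import structures.
From mathcomp Require Import all_fingroup cyclic mxabelem zify ring.
From mathcomp Require Import all_boot all_order all_algebra all_field.
From mathcomp Require Import boolp finmap mpoly.

Import Order.TTheory GRing.Theory Num.Theory.
Local Open Scope ring_scope.

(** Write q = #|F| and m = \dim {:L}.  After the coordinates of L over F are
    chosen, every form Q = Q_R is x |-> x A x^T for a square matrix A, so the
    weights are decided by the numbers N(c) of solutions of Q(x) = c: the word
    of (R, b) has weight q^m - N(-b), less 1 when b is nonzero, because the
    point x = 0 is not a coordinate of the code.

    The heart of the proof is that for a form of even rank r there is a sign
    eps with N(0) = q^(m-1) + eps (q-1) q^(m-r/2-1) and
    N(c) = q^(m-1) - eps q^(m-r/2-1) for all nonzero c ([even_rank_count]).
    Let S be the space of periods of Q (the y with Q(x+y) = Q(x) for all x);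
    its codimension is the rank ([qrankE]).  Let K be the radical of the polar
    form B, which contains S.  Three facts are combined.

    - Second moment.  Sum_c N(c)^2 counts the pairs (x, z) with
      Q(x+z) = Q(x), i.e. Q(z) + B(x,z) = 0, which is a linear equation in x;
      this gives q Sum_c N(c)^2 = q q^m |S| + q^m (q^m - |K|)
      ([qcount_second_moment]).
    - For even r, K = S ([even_corank]).  In odd characteristic
      B(x,x) = 2 Q(x) gives K = S for all r.  In characteristic 2, S has
      codimension at most 1 in K, and B is alternating, hence of even rank
      ([rank_alternating_even]), so that the parities force K = S.
    - For even r, N is constant on nonzero c ([qcount_nonzero_const]).  If c/d
      is a square this is scaling.  If c/d = nu is not a square, then 2 is
      invertible and Q can be diagonalized; in one variable, multiplication
      of the argument by nu changes the sign of the deviation of N from its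
      mean, and deviations are convolved in orthogonal sums, so in rank r the
      sign is (-1)^r ([qcount_twist]).

    With N equal to N1 on nonzero c, the first two moments yield
    (N(0) - N1)^2 = q^(2m-r), and eps is the sign of N(0) - N1.

    It remains to see that different (R, b) give different words, i.e. that
    Q_R constant on nonzero x forces R = 0.  A nonzero constant is
    excluded by counting: then R is not 0, the family has an exponent, so that
    m >= 3 and q divides both terms in the formula for N(0), whereas
    N(0) = 1 ([qform_const]).  If Q_R = 0, its polar form
    Tr(y H(x)) vanishes, where H has the monomials x^(q^l) and x^(q^(m-l))
    for the exponents l of the family; as 0 < l < m/2 these are distinct and of
    degree less than q^m, so that all coefficients are 0 ([qform_eq0]).
    Dimensions then follow by counting words, and the weight
    distributions by sorting the R according to rank and type
    ([table_sum]). *)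

Set Implicit Arguments.
Unset Strict Implicit.

(** * Subspaces of row vectors and their cardinals *)
Section Counting.
Variable F : finFieldType.
Local Notation q := #|F|.

Lemma card_kernel n p (M : 'M[F]_(n, p)) :
  #|[set x : 'rV_n | x *m M == 0]| = (q ^ (n - \rank M))%N.
Proof.
rewrite -mxrank_ker -card_rowg; apply: eq_card => x.
by rewrite !inE; apply/eqP/sub_kermxP.
Qed.

Lemma card_linform_fiber n (w : 'cV[F]_n) (c : F) : w != 0 ->
  (q * #|[set x : 'rV_n | ((x *m w) 0 0 == c)%R]| = q ^ n)%N.
Proof.
move=> w0.
have rw : \rank w = 1%N.
  by apply/eqP; rewrite eqn_leq rank_leq_col lt0n mxrank_eq0.
have [x0 Hx0] : exists x0 : 'rV_n, (x0 *m w) 0 0 = c.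
  have /matrix0Pn[i [j]] := w0; rewrite (ord1 j) => wi.
  exists (c / w i 0 *: delta_mx 0 i).
  by rewrite -scalemxAl mxE -rowE mxE divfK.
have n_gt0 : (0 < n)%N by case: n w w0 {rw x0 Hx0} => // w; rewrite flatmx0 eqxx.
have -> : #|[set x : 'rV_n | (x *m w) 0 0 == c]|
   = #|[set x : 'rV_n | x *m w == 0]|.
  rewrite -[RHS](card_imset _ (addrI x0)); apply: eq_card => y.
  rewrite inE; apply/eqP/imsetP => [Hy|[x]].
    exists (y - x0); last by rewrite addrC subrK.
    rewrite inE; apply/eqP/matrixP => i j.
    by rewrite (ord1 i) (ord1 j) mulmxBl [LHS]mxE [X in _ + X]mxE Hy Hx0 subrr mxE.
  by rewrite inE => /eqP Hx ->; rewrite mulmxDl Hx addr0.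
by rewrite card_kernel rw -expnS subn1 prednK.
Qed.

(** Turns a closed finite set of vectors into a matrix, so that ranks can be
    used for it. *)
Lemma subspace_mx n (S : {set 'rV[F]_n}) :
  0 \in S -> (forall a x y, x \in S -> y \in S -> a *: x + y \in S) ->
  exists M : 'M[F]_n, forall x, (x \in S) = (x <= M)%MS.
Proof.
move=> S0 SD; exists (\sum_(x in S) <<x>>)%MS => x.
apply/idP/idP => [Sx|].
  by apply: (sumsmx_sup x) => //; rewrite genmxE.
case/sub_sumsmxP => u ->; apply: (big_ind (fun y => y \in S)) => //.
  by move=> y z Sy Sz; rewrite -[y]scale1r SD.
move=> y Sy.
have : (u y *m <<y>> <= y)%MS by rewrite (submx_trans (submxMl _ _)) ?genmxE.
by case/sub_rVP => a ->; rewrite -[_ *: _]addr0 SD.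
Qed.

Lemma card_submx n (S : {set 'rV[F]_n}) (M : 'M[F]_n) :
  (forall x, (x \in S) = (x <= M)%MS) -> #|S| = (q ^ \rank M)%N.
Proof. by move=> SM; rewrite -card_rowg; apply: eq_card => x; rewrite SM inE. Qed.

End Counting.

(** * Value counts of quadratic forms and their second moment *)
Section QuadraticForms.
Variable F : finFieldType.
Local Notation q := #|F|.

(** The matrix need not be symmetric: this is what allows all quadratic forms
    in characteristic 2. *)
Definition qf n (A : 'M[F]_n) (x : 'rV[F]_n) : F := (x *m A *m x^T) 0 0.
(** The polar form of [qf A]. *)
Definition bf n (A : 'M[F]_n) (x y : 'rV[F]_n) : F := (x *m (A + A^T) *m y^T) 0 0.
Definition qcount n (A : 'M[F]_n) (c : F) : nat := #|[set x | qf A x == c]|.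
(** Defined as the space of periods, which depends on the function [qf A] only
    and so is easily compared with the variables that the function involves;
    [singradP] gives the usual description by the polar form. *)
Definition singrad n (A : 'M[F]_n) : {set 'rV[F]_n} :=
  [set y | [forall x, qf A (x + y) == qf A x]].
Definition bilrad n (A : 'M[F]_n) : {set 'rV[F]_n} :=
  [set y | y *m (A + A^T) == 0].

Lemma bfC n (A : 'M[F]_n) x y : bf A x y = bf A y x.
Proof.
rewrite /bf -[in LHS](trmxK (x *m _ *m _)) mxE !trmx_mul trmxK linearD /= trmxK mulmxA.
by rewrite [A^T + A]addrC.
Qed.

Lemma qfD n (A : 'M[F]_n) x y : qf A (x + y) = qf A x + qf A y + bf A x y.
Proof.
rewrite /qf /bf linearD /= !(mulmxDl, mulmxDr).
have -> : x *m A^T *m y^T = (y *m A *m x^T)^T by rewrite !trmx_mul trmxK mulmxA.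
by rewrite !mxE; ring.
Qed.

Lemma bf_diag n (A : 'M[F]_n) x : bf A x x = 2 * qf A x.
Proof.
rewrite /bf mulmxDr mulmxDl mxE.
have -> : x *m A^T *m x^T = (x *m A *m x^T)^T by rewrite !trmx_mul trmxK mulmxA.
by rewrite [_^T _ _]mxE -/(qf A x) mulr_natl mulr2n.
Qed.

Lemma qfZ n (A : 'M[F]_n) a x : qf A (a *: x) = a ^+ 2 * qf A x.
Proof. by rewrite /qf linearZ /= -!scalemxAl -scalemxAr !mxE mulrA. Qed.

Lemma qf0 n (A : 'M[F]_n) : qf A 0 = 0.
Proof. by rewrite /qf !mul0mx mxE. Qed.

Lemma bf_eq0 n (A : 'M[F]_n) y : (forall x, bf A x y = 0) <-> y \in bilrad A.
Proof.
rewrite inE; split=> [H|/eqP yA x]; last by rewrite bfC /bf yA mul0mx mxE.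
apply/eqP/rowP => i; rewrite [RHS]mxE.
have := H (delta_mx 0 i); rewrite bfC /bf => E.
by rewrite -E trmx_delta -colE [RHS]mxE.
Qed.

Lemma singradP n (A : 'M[F]_n) y :
  reflect (qf A y = 0 /\ y \in bilrad A) (y \in singrad A).
Proof.
rewrite [y \in singrad _]inE; apply: (iffP forallP) => [H|[y0 yA] x].
  have y0 : qf A y = 0 by have := eqP (H 0); rewrite add0r qf0.
  split=> //; apply/bf_eq0 => x.
  by have := H x; rewrite qfD y0 addr0 -subr_eq0 addrC addKr => /eqP.
by rewrite qfD y0 (bf_eq0 _ _).2 // !addr0.
Qed.

Lemma sum_qcount n (A : 'M[F]_n) : (\sum_c qcount A c = q ^ n)%N.
Proof.
rewrite -[(q ^ n)%N](_ : #|'rV[F]_n| = _); last by rewrite card_mx mul1n.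
rewrite -sum1_card (partition_big (qf A) predT) //=.
by apply: eq_bigr => c _; rewrite sum1_card /qcount cardsE.
Qed.

(** The left-hand sum counts the pairs (x, z) with Q(x+z) = Q(x), that is
    Q(z) + B(x,z) = 0.  For fixed z in the radical of B, all x or none satisfy
    this, according to Q(z) being 0 or not; for any other z it is a nontrivial affine
    equation in x.  The factor q avoids the exponent n - 1 at n = 0. *)
Lemma qcount_second_moment n (A : 'M[F]_n) :
  (q * \sum_c qcount A c ^ 2
     = q * (q ^ n * #|singrad A|) + q ^ n * (q ^ n - #|bilrad A|))%N.
Proof.
have -> : (\sum_c qcount A c ^ 2
    = \sum_z #|[set x | (qf A z + bf A x z == 0)%R]|)%N.
  transitivity (\sum_x #|[set y | (qf A y == qf A x)%R]|)%N.
    rewrite (partition_big (qf A) predT) //=; apply: eq_bigr => c _.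
    rewrite (eq_bigr (fun=> qcount A c)) => [|x /eqP->] //.
    by rewrite sum_nat_const; congr muln; rewrite /qcount cardsE.
  transitivity (\sum_x \sum_z ((qf A z + bf A x z == 0)%R : nat))%N.
    apply: eq_bigr => x _; rewrite -sum1_card big_mkcond /=.
    rewrite (reindex_inj (addrI x)) /=; apply: eq_bigr => z _.
    by rewrite inE qfD -addrA -subr_eq0 [qf A x + _]addrC addrK; case: eqP.
  rewrite exchange_big /=; apply: eq_bigr => z _.
  by rewrite -sum1_card [RHS]big_mkcond; apply: eq_bigr => x _; rewrite inE; case: eqP.
rewrite (bigID (mem (bilrad A))) /= mulnDr; congr addn.
  congr muln; rewrite (bigID (mem (singrad A))) /= [X in (_ + X)%N]big1 ?addn0.
    rewrite (eq_bigr (fun=> q ^ n)%N) => [|z /andP[zK /singradP[z0 _]]].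
      rewrite sum_nat_const mulnC; congr muln; apply: eq_card => z.
      rewrite unfold_in /=; case: (boolP (z \in singrad A)); rewrite ?andbF //.
      by case/singradP => _ ->.
    rewrite -[RHS](_ : #|'rV[F]_n| = _); last by rewrite card_mx mul1n.
    by rewrite -cardsT; apply: eq_card => x; rewrite !inE z0 add0r (bf_eq0 _ _).2 ?eqxx.
  move=> z /andP[zK zS]; apply/eqP; rewrite cards_eq0 -subset0.
  apply/subsetP => x; rewrite inE (bf_eq0 _ _).2 // addr0 => /eqP z0.
  by case/singradP: zS.
rewrite big_distrr /= (eq_bigr (fun=> q ^ n)%N) => [|z zK].
  rewrite sum_nat_const mulnC; congr muln.
  rewrite [#|bilrad A|]cardsCs card_mx mul1n subKn; last first.
    by rewrite -[X in (_ <= X)%N](_ : #|'rV[F]_n| = _) ?max_card // card_mx mul1n.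
  by apply: eq_card => z; rewrite !inE unfold_in /= inE.
have w0 : (A + A^T) *m z^T != 0.
  apply: contraNneq zK => E; apply/bf_eq0 => x.
  by rewrite /bf -mulmxA E mulmx0 mxE.
rewrite -(card_linform_fiber (- qf A z) w0); congr muln; apply: eq_card => x.
by rewrite !inE /bf -mulmxA -addr_eq0 addrC.
Qed.

End QuadraticForms.

(** * Diagonalization in odd characteristic *)
Section Congruence.
Variable F : finFieldType.
Local Notation q := #|F|.

Lemma qcount_congr n (A P : 'M[F]_n) c : P \in unitmx ->
  qcount (P *m A *m P^T) c = qcount A c.
Proof.
move=> uP; have inj : injective (fun x : 'rV_n => x *m P) by apply: can_inj (mulmxK uP).
rewrite /qcount -(card_imset _ inj); apply: eq_card => y.
have E x : qf (P *m A *m P^T) x = qf A (x *m P).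
  by rewrite /qf trmx_mul !mulmxA.
rewrite [RHS]inE; apply/imsetP/idP => [[x]|Hy].
  by rewrite inE E => xc ->.
by exists (y *m invmx P); rewrite ?mulmxKV // inE E mulmxKV.
Qed.

Lemma rank_congr n (A P : 'M[F]_n) : P \in unitmx ->
  \rank (P *m A *m P^T) = \rank A.
Proof.
move=> uP; rewrite mxrankMfree ?row_free_unit ?unitmx_tr //.
by rewrite (eqmxMfull A (_ : row_full P)) // row_full_unit.
Qed.

Lemma sym_congr n (A P : 'M[F]_n) : A^T = A -> (P *m A *m P^T)^T = P *m A *m P^T.
Proof. by move=> As; rewrite !trmx_mul trmxK As mulmxA. Qed.

(** If 2 is invertible, a nonzero symmetric matrix takes a nonzero value Q(v),
    by polarization; complete v to a basis. *)
Lemma symm_pivot n (A : 'M[F]_n.+1) : 2 != 0 :> F -> A^T = A -> A != 0 ->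
  exists2 P : 'M[F]_n.+1, P \in unitmx & (P *m A *m P^T) 0 0 != 0.
Proof.
move=> two As A0.
have [v qv] : exists v, qf A v != 0.
  apply/existsP; rewrite -[[exists _, _]]negbK negb_exists.
  apply: contraNN A0 => /forallP H.
  have {}H x : qf A x = 0 by apply/eqP; have := H x; rewrite negbK.
  apply/eqP/matrixP => i j; rewrite mxE.
  have : bf A (delta_mx 0 i) (delta_mx 0 j) = 0.
    by have := qfD A (delta_mx 0 i) (delta_mx 0 j); rewrite !H !add0r.
  rewrite /bf As trmx_delta -colE -rowE [X in X = _]mxE [X in X = _]mxE [X in X = _]mxE.
  by rewrite -mulr2n -mulr_natl => /eqP; rewrite mulf_eq0 (negPf two) => /eqP.
have v0 : v != 0 by apply: contraNneq qv => ->; rewrite qf0.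
(* [row_ebase v] is an invertible matrix whose first row is proportional to v. *)
have Ev := mulmx_ebase v; have uE := row_ebase_unit v.
set E := row_ebase v in Ev uE.
have rv : \rank v = 1%N by apply/eqP; rewrite eqn_leq rank_leq_row lt0n mxrank_eq0.
have Ev' : v = col_ebase v 0 0 *: row 0 E.
  rewrite -{1}Ev rv -mulmxA [col_ebase v]mx11_scalar mul_scalar_mx; congr (_ *: _).
    by rewrite mxE eqxx.
  apply/rowP => j; rewrite !mxE (bigD1 0) //= big1 => [|k k0].
    by rewrite !mxE mul1r addr0.
  by rewrite !mxE /= eq_sym (negPf (_ : k != 0%N :> nat)) ?mul0r.
exists E => //.
apply: contraNneq qv => E0.
suff -> : qf A v = col_ebase v 0 0 ^+ 2 * (E *m A *m E^T) 0 0 by rewrite E0 mulr0.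
rewrite {1}Ev' qfZ; congr (_ * _).
rewrite /qf -!row_mul mxE -[RHS]/((E *m A *m E^T) 0 0) !mxE.
by apply: eq_bigr => k _; rewrite !mxE.
Qed.

(** Schur complement of the pivot. *)
Lemma symm_split n (A : 'M[F]_n.+1) : 2 != 0 :> F -> A^T = A -> A != 0 ->
  exists P : 'M[F]_(1 + n), exists a, exists A1 : 'M[F]_n,
   [/\ P \in unitmx, a != 0, A1^T = A1 & P *m A *m P^T = block_mx a%:M 0 0 A1].
Proof.
move=> two As A0; have [P uP] := symm_pivot two As A0.
set M := (P *m A *m P^T : 'M_(1 + n)); set a := (_ 0 0) => a0.
have Ms : M^T = M by apply: sym_congr.
have Ma : ulsubmx M = a%:M.
  rewrite [LHS]mx11_scalar; congr (_%:M); rewrite [LHS]mxE [LHS]mxE.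
  by rewrite /a; congr (M _ _); apply: val_inj.
pose b := ursubmx M; pose C := drsubmx M.
have Mb : dlsubmx M = b^T by rewrite /b -[in RHS]Ms trmx_ursub trmxK.
have Cs : C^T = C by rewrite /C trmx_drsub Ms.
have EM : M = block_mx a%:M b b^T C by rewrite -[LHS]submxK Ma Mb.
pose E : 'M[F]_(1 + n) := block_mx 1%:M 0 (- (a^-1 *: b^T)) 1%:M.
exists (E *m P), a, (C - a^-1 *: (b^T *m b)); split=> //.
- by rewrite unitmx_mul uP andbT unitmxE det_lblock !det1 mulr1 unitr1.
- by rewrite linearB /= linearZ /= trmx_mul trmxK Cs.
transitivity (E *m M *m E^T); first by rewrite /M trmx_mul !mulmxA.
rewrite EM /E tr_block_mx !mulmx_block !trmx0 !trmx1 !(mul1mx, mulmx1, mul0mx, mulmx0, addr0, add0r).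
have H : - (a^-1 *: b^T) *m a%:M = - b^T.
  by rewrite mul_mx_scalar scalerN scalerA mulfV ?scale1r.
congr block_mx.
- by rewrite linearN /= linearZ /= trmxK mul_scalar_mx scalerN scalerA mulfV ?scale1r ?addNr.
- by rewrite H addNr.
- by rewrite H addNr mul0mx add0r mulNmx -scalemxAl addrC.
Qed.

Lemma qf_block n a (A : 'M[F]_n) (t : 'M[F]_1) y :
  qf (block_mx a%:M 0 0 A : 'M_(1 + n)) (row_mx t y) = a * t 0 0 ^+ 2 + qf A y.
Proof.
rewrite /qf mul_row_block tr_row_mx !mulmx0 addr0 add0r mul_row_col mxE; congr (_ + _).
by rewrite mul_mx_scalar -scalemxAl mxE [(t *m _) 0 0]mxE big_ord1 mxE.
Qed.

(** In odd characteristic this is 1 + chi(u), chi the quadratic character. *)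
Definition nroots2 (u : F) : nat := #|[set t : F | t ^+ 2 == u]|.

Lemma qcount_block n a (A : 'M[F]_n) c :
  qcount (block_mx a%:M 0 0 A : 'M_(1 + n)) c
  = (\sum_u nroots2 u * qcount A (c - a * u)%R)%N.
Proof.
transitivity (\sum_(t : F) qcount A (c - a * t ^+ 2)%R)%N; last first.
  rewrite (partition_big (fun t : F => t ^+ 2) predT) //=; apply: eq_bigr => u _.
  rewrite (eq_bigr (fun=> qcount A (c - a * u))) => [|t /eqP->//].
  by rewrite sum_nat_const /nroots2 cardsE.
have -> : qcount (block_mx a%:M 0 0 A : 'M_(1 + n)) c
   = #|[set z : F * 'rV[F]_n | a * z.1 ^+ 2 + qf A z.2 == c]|.
  pose f (z : F * 'rV[F]_n) : 'rV[F]_(1 + n) := row_mx z.1%:M z.2.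
  have fi : injective f.
    move=> [t y] [t' y'] /eq_row_mx[/= E ->]; congr (_, _).
    by have := congr1 (fun M : 'M[F]_1 => M 0 0) E; rewrite !mxE eqxx.
  rewrite /qcount -[RHS](card_imset _ fi); apply: eq_card => x.
  rewrite inE; apply/idP/imsetP => [Hx|[[t y]]].
    exists (lsubmx x 0 0, rsubmx x); last by rewrite /f /= -mx11_scalar hsubmxK.
    by move: Hx; rewrite -{1}(hsubmxK x) qf_block inE.
  by rewrite inE => Hz ->; rewrite qf_block mxE eqxx.
rewrite -sum1_card big_mkcond /= (eq_bigr (fun z : F * 'rV[F]_n =>
  (a * z.1 ^+ 2 + qf A z.2 == c)%R : nat)) => [|z _]; last by rewrite inE; case: eqP.
rewrite -(pair_bigA _ (fun t y => (a * t ^+ 2 + qf A y == c)%R : nat)) /=.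
apply: eq_bigr => t _; rewrite /qcount -sum1_card [RHS]big_mkcond /=.
by apply: eq_bigr => y _; rewrite inE [_ + qf A y]addrC -[in RHS](inj_eq (addIr (a * t ^+ 2))) subrK; case: eqP.
Qed.

Lemma nroots2_0 : nroots2 0 = 1%N.
Proof.
rewrite /nroots2 -(cards1 (0 : F)); apply: eq_card => t.
by rewrite !inE expf_eq0.
Qed.

Lemma sum_nroots2 : (\sum_u nroots2 u = q)%N.
Proof.
rewrite -[RHS]sum1_card [RHS](partition_big (fun t : F => t ^+ 2) predT) //=.
by apply: eq_bigr => u _; rewrite /nroots2 -sum1_card; apply: eq_bigl => t; rewrite inE.
Qed.

(** The pointwise bound by 2 holds because u and nu * u cannot both be nonzero
    squares; it is attained everywhere since both sides have the sum 2q. *)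
Lemma nroots2_nonsquare nu u : (forall t : F, t ^+ 2 != nu) ->
  (nroots2 u + nroots2 (nu * u)%R = 2)%N.
Proof.
move=> nuP.
have nu0 : nu != 0 by have := nuP 0; rewrite expr0n eq_sym.
have le2 w : (nroots2 w <= 2)%N.
  rewrite /nroots2; have [->|[t]] := set_0Vmem [set t : F | t ^+ 2 == w]; first by rewrite cards0.
  rewrite inE => /eqP <-; apply: (@leq_trans #|[set t; - t]|).
    by apply/subset_leq_card/subsetP => s; rewrite !inE eqf_sqr.
  by rewrite cards2; case: (_ != _).
have le2' w : (nroots2 w + nroots2 (nu * w)%R <= 2)%N.
  have [->|w0] := eqVneq w 0; first by rewrite mulr0 nroots2_0.
  have [->|/eqP] := eqVneq (nroots2 (nu * w)%R) 0%N; first by rewrite addn0.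
  move=> /eqP; rewrite cards_eq0 => /set0Pn[s]; rewrite inE => /eqP s2.
  suff -> : nroots2 w = 0%N by rewrite add0n.
  apply/eqP; rewrite cards_eq0; apply/set0Pn => -[t]; rewrite inE => /eqP t2.
  by have := nuP (s / t); rewrite expr_div_n s2 t2 mulfK ?eqxx.
have SE : (\sum_w (nroots2 w + nroots2 (nu * w)%R) = \sum_(w : F) 2)%N.
  rewrite big_split /= sum_nroots2 sum_nat_const.
  have <- := reindex_inj (mulfI nu0) (P := predT) (F := nroots2).
  by rewrite sum_nroots2 addnn muln2.
have /eqP := SE; rewrite (leqif_sum (fun w _ => leqif_eq (le2' w))).
by move/forallP/(_ u)/eqP.
Qed.
End Congruence.

(** * Equidistribution of the nonzero values in even rank *)
Section Equidistribution.
Variable F : finFieldType.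
Local Notation q := #|F|.

Lemma PoszX a k : (a ^ k)%N%:Z = a%:Z ^+ k.
Proof. by elim: k => // k IHk; rewrite expnS PoszM IHk exprS. Qed.

Lemma Posz_sum (I : finType) (f : I -> nat) :
  (\sum_i f i)%N%:Z = \sum_i (f i)%:Z.
Proof. exact: (big_morph Posz PoszD (erefl _)). Qed.

(** The function q N(c) - q^n is q times the deviation of N from its mean.  Each
    diagonal coefficient contributes a convolution with [nroots2], whose own
    deviation from the mean 1 is odd under multiplication by nu; hence one
    change of sign per unit of rank. *)
Lemma qcount_twist nu n (A : 'M[F]_n) c :
  (forall t : F, t ^+ 2 != nu) -> 2 != 0 :> F -> A^T = A ->
  q%:Z * (qcount A (nu * c))%:Z - q%:Z ^+ n
    = (-1) ^+ \rank A * (q%:Z * (qcount A c)%:Z - q%:Z ^+ n).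
Proof.
move=> nuP two.
have nu0 : nu != 0 by have := nuP 0; rewrite expr0n eq_sym.
elim: n A c => [|n IHn] A c As.
  have -> : \rank A = 0%N by apply/eqP; rewrite -leqn0 rank_leq_row.
  rewrite expr0 mul1r; congr (_ * Posz _ - _).
  apply: eq_card => x; rewrite !inE.
  suff -> : qf A x = 0 by rewrite ![0 == _]eq_sym mulf_eq0 (negPf nu0).
  by rewrite /qf mxE big_ord0.
have [A0|A0] := eqVneq A 0.
  rewrite A0 mxrank0 expr0 mul1r; congr (_ * Posz _ - _).
  apply: eq_card => x; rewrite !inE.
  suff -> : qf 0 x = 0 by rewrite ![0 == _]eq_sym mulf_eq0 (negPf nu0).
  by rewrite /qf mulmx0 mul0mx mxE.
have [P [a [A1 [uP a0 A1s PA]]]] := symm_split two As A0.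
have r1 : \rank (a%:M : 'M[F]_1) = 1%N.
  by rewrite mxrank_unit // unitmxE det_scalar1 unitfE.
have rk : \rank A = (1 + \rank A1)%N.
  rewrite -(rank_congr A uP) PA.
  by have := rank_diag_block_mx (a%:M : 'M[F]_1) A1; rewrite r1 => <-.
rewrite rk -!(qcount_congr A _ uP) PA.
rewrite !qcount_block add1n [(-1) ^+ _.+1]exprS mulN1r mulNr.
set K := q%:Z ^+ n; set s := (-1) ^+ _.
(* Only deviations matter: K is the mean, up to the factor q. *)
have E1 d : q%:Z * (\sum_u nroots2 u * qcount A1 (d - a * u)%R)%N%:Z
   = \sum_u (nroots2 u)%:Z * (q%:Z * (qcount A1 (d - a * u))%:Z - K) + q%:Z * K.
  have -> : q%:Z * K = \sum_(u : F) (nroots2 u)%:Z * K.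
    by rewrite -mulr_suml -Posz_sum sum_nroots2.
  rewrite Posz_sum mulr_sumr -big_split /=.
  by apply: eq_bigr => u _; rewrite PoszM; ring.
have S0 d : \sum_u (q%:Z * (qcount A1 (d - a * u))%:Z - K) = 0.
  rewrite sumrB -mulr_sumr -Posz_sum.
  have inj : injective (fun u : F => d - a * u).
    by move=> u v /addrI/oppr_inj/(mulfI a0).
  have -> : (\sum_i qcount A1 (d - a * i)%R = \sum_u qcount A1 u)%N.
    by rewrite [RHS](reindex_inj inj).
  rewrite sum_qcount sumr_const.
  by rewrite -mulr_natl natz PoszX subrr.
rewrite !E1 exprS addrK addrK.
rewrite (reindex_inj (mulfI nu0)) /=.
rewrite (eq_bigr (fun u => s * (2 * (q%:Z * (qcount A1 (c - a * u))%:Z - K)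
    - (nroots2 u)%:Z * (q%:Z * (qcount A1 (c - a * u))%:Z - K)))); last first.
  move=> u _.
  have -> : nu * c - a * (nu * u) = nu * (c - a * u) by ring.
  rewrite IHn // -/s -/K.
  have -> : (nroots2 (nu * u))%:Z = 2 - (nroots2 u)%:Z.
    by rewrite -[2](congr1 Posz (nroots2_nonsquare u nuP)) PoszD addrAC subrr add0r.
  by ring.
by rewrite -mulr_sumr sumrB -mulr_sumr S0 mulr0 sub0r mulrN.
Qed.

Lemma qcount_scale n (A : 'M[F]_n) t c : t != 0 ->
  qcount A (t ^+ 2 * c) = qcount A c.
Proof.
move=> t0; have inj : injective (fun x : 'rV[F]_n => t *: x) by apply: scalerI.
rewrite /qcount -[RHS](card_imset _ inj); apply: eq_card => y.
have t20 : t ^+ 2 != 0 by rewrite expf_eq0.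
rewrite inE; apply/idP/imsetP => [/eqP Hy|[x]].
  exists (t^-1 *: y); last by rewrite scalerA mulfV ?scale1r.
  by rewrite inE qfZ Hy exprVn mulrA mulVf // mul1r.
by rewrite inE => /eqP xc ->; rewrite qfZ xc.
Qed.

Lemma squares_char2 : 2 = 0 :> F -> forall c : F, exists t, t ^+ 2 = c.
Proof.
move=> two c; have inj : injective (fun t : F => t ^+ 2).
  move=> x y /eqP; rewrite -subr_eq0 => /eqP E; apply/eqP; rewrite -subr_eq0.
  rewrite -sqrf_eq0; have -> : (x - y) ^+ 2 = x ^+ 2 - y ^+ 2 + 2 * (y ^+ 2 - x * y) by ring.
  by rewrite E two mul0r addr0.
by have [g gK Kg] := injF_bij inj; exists (g c).
Qed.

Lemma qcount_nonzero_const n (A : 'M[F]_n) c d :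
  ~~ odd (\rank (A + A^T)%R) -> c != 0 -> d != 0 -> qcount A c = qcount A d.
Proof.
move=> ev c0 d0.
have [t t2|nsq] := pickP (fun t : F => t ^+ 2 == c / d).
  have t0 : t != 0.
    by apply: contraTneq t2 => ->; rewrite expr0n eq_sym mulf_eq0 invr_eq0 negb_or c0.
  by rewrite -[c](divfK d0) -(eqP t2) qcount_scale.
have two : 2 != 0 :> F.
  apply/eqP => two; have [t Et] := squares_char2 two (c / d).
  by have := nsq t; rewrite Et eqxx.
pose A' := 2^-1 *: (A + A^T).
have As : A'^T = A' by rewrite /A' linearZ /= linearD /= trmxK addrC.
have QA x : qf A' x = qf A x.
  by rewrite /qf /A' -scalemxAr -scalemxAl mxE -/(bf A x x) bf_diag mulKf.
have NA e : qcount A' e = qcount A e by apply: eq_card => x; rewrite !inE QA.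
have := qcount_twist d (fun t => negbT (nsq t)) two As.
rewrite divfK // !NA /A' mxrank_scale_nz ?invr_eq0 // -signr_odd (negPf ev) mul1r.
move/addIr; have q0 : q%:Z != 0 by rewrite -lt0n (ltnW (finNzRing_gt1 F)).
by move/(mulfI q0) => -[].
Qed.

(* Lagrangian *)
(** A totally isotropic subspace W of maximal dimension is its own orthogonal,
    since any v orthogonal to W could be added to it, B(v,v) being 0.
    Comparing dimensions gives rank B = 2 (n - dim W). *)
Lemma rank_alternating_even n (B : 'M[F]_n) :
  B^T = - B -> (forall x : 'rV_n, (x *m B *m x^T) 0 0 = 0) -> ~~ odd (\rank B).
Proof.
move=> Ba Bx.
pose P w := [exists W : 'M[F]_n, (\rank W == w) && (W *m B *m W^T == 0)].
have P0 : exists w, P w.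
  by exists 0%N; apply/existsP; exists 0; rewrite mxrank0 eqxx !mul0mx eqxx.
have Pn w : P w -> (w <= n)%N by case/existsP => W /andP[/eqP <- _]; apply: rank_leq_row.
case: (ex_maxnP P0 Pn) => w /existsP[W /andP[/eqP rW /eqP WW]] maxw.
have orth (v : 'rV_n) : v *m (B *m W^T) = 0 -> (v <= W)%MS.
  move=> vW; apply: contraT => vnW.
  suff /maxw : P (\rank (W + v)%MS).
    rewrite -rW => le; case/negP: vnW.
    have := mxrank_leqif_sup (addsmxSl W v); rewrite /leqif => -[le2].
    by rewrite eqn_leq le2 le /= => /esym/(submx_trans (addsmxSr W v)).
  apply/existsP; exists (W + v)%MS; rewrite eqxx /=.
  have /eqmxP/andP[/submxP[D ->] _] : (W + v :=: col_mx W v)%MS by apply: addsmxE.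
  rewrite trmx_mul !mulmxA -[D *m _ *m B]mulmxA -[D *m _ *m _]mulmxA.
  suff -> : col_mx W v *m B *m (col_mx W v)^T = 0 by rewrite mulmx0 mul0mx.
  rewrite mul_col_mx tr_col_mx mul_col_row WW -[v *m B *m W^T]mulmxA vW.
  have -> : W *m B *m v^T = 0.
    by apply: trmx_inj; rewrite !trmx_mul trmxK Ba mulNmx mulmxN vW oppr0 trmx0.
  have -> : v *m B *m v^T = 0 by rewrite [LHS]mx11_scalar Bx raddf0.
  exact: block_mx0.
have kW : (kermx (B *m W^T) :=: W)%MS.
  apply/eqmxP/andP; split; last by apply/sub_kermxP; rewrite mulmxA.
  by apply/row_subP => i; apply: orth; apply/sub_kermxP; apply: row_sub.
have BW : (kermx B <= W)%MS.
  by rewrite -kW; apply/sub_kermxP; rewrite mulmxA mulmx_ker mul0mx.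
have e1 := mxrank_ker (B *m W^T); rewrite kW in e1.
have e2 : \rank (B *m W^T) = \rank (W *m B).
  by rewrite -mxrank_tr trmx_mul trmxK Ba mulmxN mxrank_opp.
have e3 := mxrank_mul_ker W B.
have e4 : \rank (W :&: kermx B)%MS = \rank (kermx B) by rewrite (capmx_idPr BW).
rewrite e4 mxrank_ker in e3.
(* dim W^perp = n - rank (B W^T), where rank (W B) = dim W - dim ker B. *)
have ek : (\rank B = 2 * (n - \rank W))%N.
  move: (rank_leq_row (B *m W^T)) (rank_leq_row B) (rank_leq_row W) e1 e3.
  rewrite e2; move: (\rank (W *m B)) (\rank B) (\rank W); lia.
by rewrite ek mul2n odd_double.
Qed.

Lemma bilrad_card n (A : 'M[F]_n) : #|bilrad A| = (q ^ (n - \rank (A + A^T)%R))%N.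
Proof. exact: card_kernel. Qed.

Lemma singrad_sub n (A : 'M[F]_n) : singrad A \subset bilrad A.
Proof. by apply/subsetP => x /singradP[]. Qed.

(** On the radical of the polar form, Q is additive with kernel the periods, so
    each of its q fibres is empty or a coset of that kernel. *)
Lemma bilrad_le n (A : 'M[F]_n) : (#|bilrad A| <= q * #|singrad A|)%N.
Proof.
rewrite -sum1_card (partition_big (qf A) predT) //= -[q]/(#|F|) -sum_nat_const.
apply: leq_sum => c _; rewrite sum1_card.
case: (pickP [pred x in bilrad A | qf A x == c]) => [x0 /andP[x0K /eqP x0c]|H]; last first.
  by rewrite eq_card0.
rewrite -(card_imset (mem (singrad A)) (addrI x0)); apply: subset_leq_card.
apply/subsetP => x /andP[xK /eqP xc]; apply/imsetP.
exists (x - x0); last by rewrite addrC subrK.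
have KB y z : y \in bilrad A -> z \in bilrad A -> y - z \in bilrad A.
  by rewrite !inE => /eqP yK /eqP zK; rewrite mulmxBl yK zK subrr.
have dK := KB _ _ xK x0K.
apply/singradP; split => //.
have := qfD A x0 (x - x0); rewrite [x0 + _]addrC subrK xc x0c (bf_eq0 _ _).2 // addr0.
by move/(congr1 (fun z => z - c)); rewrite subrr [c + _]addrC addrK.
Qed.

Lemma singrad_mx n (A : 'M[F]_n) :
  exists M : 'M[F]_n, forall x, (x \in singrad A) = (x <= M)%MS.
Proof.
apply: subspace_mx => [|a x y].
  by apply/singradP; rewrite qf0 inE mul0mx.
move=> /singradP[x0 xK] /singradP[y0 yK]; apply/singradP; split.
  by rewrite qfD qfZ x0 y0 (bf_eq0 _ _).2 // mulr0 !addr0.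
by move: xK yK; rewrite !inE mulmxDl -scalemxAl => /eqP-> /eqP->; rewrite scaler0 addr0.
Qed.

(** In odd characteristic the two radicals agree.  In characteristic 2 their
    dimensions differ by at most 1, and both codimensions are even. *)
Lemma even_corank n (A M : 'M[F]_n) : (forall x, (x \in singrad A) = (x <= M)%MS) ->
  ~~ odd (n - \rank M) -> \rank (A + A^T)%R = (n - \rank M)%N.
Proof.
move=> SM ev; have cS := card_submx SM; have cK := bilrad_card A.
have le1 := subset_leq_card (singrad_sub A); have le2 := bilrad_le A.
have rM := rank_leq_row M; have rB := rank_leq_row (A + A^T).
rewrite cS cK -?expnS !leq_exp2l ?finNzRing_gt1 // in le1 le2.
have [two|two] := eqVneq (2 : F) 0; last first.
  have E : bilrad A \subset singrad A.
    apply/subsetP => x xK; apply/singradP; split=> //.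
    have /eqP := (bf_eq0 A x).2 xK x.
    by rewrite bf_diag mulf_eq0 (negPf two) => /eqP.
  have := subset_leq_card E; rewrite cS cK leq_exp2l ?finNzRing_gt1 //.
  move: le1 rM rB; move: (\rank M) (\rank _); lia.
have : ~~ odd (\rank (A + A^T)%R).
  apply: rank_alternating_even.
    have opp (z : F) : - z = z by apply/eqP; rewrite -subr_eq0 -opprD oppr_eq0 -mulr2n -mulr_natl two mul0r.
    by apply/matrixP => i j; rewrite !mxE opp addrC.
  by move=> x; rewrite -/(bf A x x) bf_diag two mul0r.
move: ev le1 le2 rM rB; move: (\rank M) (\rank _); lia.
Qed.

(** With N1 the common value on nonzero c, the first moment is
    N(0) + (q-1) N1 = q^n, and substituting in the second moment leaves
    (N(0) - N1)^2 = q^(2n-r). *)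
Theorem even_rank_count n (A M : 'M[F]_n) :
  (0 < n)%N -> (forall x, (x \in singrad A) = (x <= M)%MS) -> ~~ odd (n - \rank M) ->
  exists2 eps : int, eps = 1 \/ eps = -1 &
    forall c, (qcount A c)%:Z = q%:Z ^+ (n - 1)
       + eps * (if c == 0 then q%:Z - 1 else - 1) * q%:Z ^+ (n - (n - \rank M)./2 - 1).
Proof.
move=> n0 SM ev; have rB := even_corank SM ev; have rM := rank_leq_row M.
set h := (n - \rank M)./2; have hE : (n - \rank M = 2 * h)%N by rewrite /h; lia.
have q0 : q%:Z != 0 by rewrite -lt0n (ltnW (finNzRing_gt1 F)).
have q1 : q%:Z - 1 != 0 by rewrite subr_eq0; have := finNzRing_gt1 F; case: q => [|[]].
pose N0 := (qcount A 0)%:Z; pose N1 := (qcount A 1)%:Z.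
have N1E c : c != 0 -> qcount A c = qcount A 1.
  by move=> c0; apply: qcount_nonzero_const; rewrite ?rB // oner_neq0.
have cF : #|[pred c : F | c != 0]|%:Z = q%:Z - 1.
  have := cardC1 (0 : F); have := finNzRing_gt1 F.
  rewrite (_ : #|predC1 0| = #|[pred c : F | c != 0]|) // => q1' ->.
  by rewrite -subn1 subzn // ltnW.
have S1 : N0 + (q%:Z - 1) * N1 = q%:Z ^+ n.
  have := sum_qcount A; rewrite (bigD1 0) //= (eq_bigr (fun=> qcount A 1)) => [|c c0]; last exact: N1E.
  by rewrite sum_nat_const => /(congr1 Posz); rewrite PoszD PoszM PoszX cF.
have S2 : q%:Z * (N0 ^+ 2 + (q%:Z - 1) * N1 ^+ 2)
    = q%:Z * (q%:Z ^+ n * q%:Z ^+ (n - 2 * h)) + q%:Z ^+ n * (q%:Z ^+ n - q%:Z ^+ (n - 2 * h)).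
  have := qcount_second_moment A; rewrite bilrad_card (card_submx SM) rB.
  rewrite (bigD1 0) //= (eq_bigr (fun=> (qcount A 1%R ^ 2)%N)) => [|c c0]; last by rewrite N1E.
  rewrite sum_nat_const => /(congr1 Posz); rewrite !(PoszD, PoszM, PoszX) cF.
  rewrite -subzn ?leq_exp2l ?finNzRing_gt1 ?leq_subr // !PoszX.
  have -> : (n - (n - \rank M) = n - 2 * h)%N by lia.
  by have -> : (\rank M = n - 2 * h)%N by lia.
have D2 : (N0 - N1) ^+ 2 = (q%:Z ^+ (n - h)) ^+ 2.
  rewrite -exprM (_ : ((n - h) * 2 = n + (n - 2 * h))%N); last by lia.
  rewrite exprD; apply: (mulfI q1).
  move: S2; rewrite -S1; set Z := q%:Z ^+ (n - 2 * h) => S2.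
  apply/eqP; rewrite -subr_eq0 -[X in _ == X](subrr (q%:Z * (N0 ^+ 2 + (q%:Z - 1) * N1 ^+ 2))).
  by rewrite {2}S2; apply/eqP; ring.
have En : q%:Z ^+ n = q%:Z * q%:Z ^+ (n - 1) by rewrite -exprS subn1 prednK.
have Eh : q%:Z ^+ (n - h) = q%:Z * q%:Z ^+ (n - h - 1).
  have hn : (h < n)%N by move: n0 hE; clear; lia.
  by rewrite -exprS [(_ - 1)%N]subn1 prednK // subn_gt0.
have [eps He ED] : exists2 eps : int, eps = 1 \/ eps = -1 & N0 - N1 = eps * q%:Z ^+ (n - h).
  move/eqP: D2; rewrite eqf_sqr => /orP[]/eqP ->; [exists 1|exists (-1)]; rewrite ?mul1r ?mulN1r //; by [left|right].
exists eps => // c.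
have H1 : N1 = q%:Z ^+ (n - 1) - eps * q%:Z ^+ (n - h - 1).
  apply: (mulfI q0); move: ED S1; rewrite Eh En => ED S1.
  by rewrite mulrBr -S1 [q%:Z * (eps * _)]mulrCA -ED; ring.
case: eqP => [->|/eqP c0].
  rewrite -/N0; have -> : N0 = N1 + eps * q%:Z ^+ (n - h) by rewrite -ED; ring.
  by rewrite Eh H1; ring.
by rewrite (N1E _ c0) -/N1 H1; ring.
Qed.

End Equidistribution.

(** * The rank as the codimension of the space of periods *)
Section Rank.
Variables (F : finFieldType) (L : fieldExtType F).
Local Notation q := #|F|.
Local Notation m := (\dim {:L}).
Implicit Types (Q : L -> F) (A : 'M[F]_m).

Local Notation uncoords := (passmx.vecof (vbasis {:L})).

Lemma uncoordsK : cancel uncoords (@coords F L).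
Proof. exact: passmx.vecofK (vbasisP _). Qed.

Lemma coordsK : cancel (@coords F L) uncoords.
Proof. exact: passmx.rVofK (vbasisP _). Qed.

Lemma dim_gt0 : (0 < m)%N.
Proof. by rewrite lt0n dimv_eq0 -subv0; apply/negP => /subvP/(_ 1 (memvf _)); rewrite memv0 oner_eq0. Qed.

Lemma meval_first_vars n r (p : {mpoly F[n]}) (v w : 'I_n -> F) :
  (forall mon, mon \in msupp p -> forall i : 'I_n, mon i != 0%N -> (i < r)%N) ->
  (forall i : 'I_n, (i < r)%N -> v i = w i) -> p.@[v] = p.@[w].
Proof.
move=> supp vw; rewrite !mevalE; apply: eq_big_seq => mon /supp Hm.
congr (_ * _); apply: eq_bigr => i _.
by have [->|/Hm/vw ->//] := eqVneq (mon i) 0%N; rewrite !expr0.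
Qed.

Lemma mul_pid_mxE n r (y : 'rV[F]_n) i : (y *m pid_mx r) 0 i = y 0 i *+ (i < r)%N.
Proof.
rewrite mxE (bigD1 i) //= big1 => [|k ki]; last by rewrite mxE (negPf (_ : k != i :> nat)) ?mulr0.
by rewrite mxE eqxx addr0 /=; case: (i < r)%N; rewrite ?mulr1 ?mulr0.
Qed.

(** The q^(m-r) vectors whose first r coordinates vanish in the new basis are
    periods. *)
Lemma representable_le Q A r : (forall x, Q x = qf A (coords x)) ->
  (r <= m)%N -> representable Q r -> (q ^ (m - r) <= #|singrad A|)%N.
Proof.
move=> QA rm [P [p [uP _ supp Qp]]].
have rk : \rank (P *m pid_mx r : 'M_m) = r.
  by rewrite (eqmxMfull _ (_ : row_full P)) ?row_full_unit // rank_pid_mx.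
rewrite -[in X in (_ ^ X)%N]rk -card_kernel; apply: subset_leq_card.
apply/subsetP => z; rewrite !inE => /eqP z0; apply/forallP => x; apply/eqP.
have E u : qf A u = p.@[fun i => (u *m P) 0 i] by rewrite -{1}[u]uncoordsK -QA Qp uncoordsK.
rewrite !E; apply: (meval_first_vars supp) => i ir.
rewrite mulmxDl mxE; have /rowP/(_ i) := z0; rewrite mulmxA mul_pid_mxE ir mulr1n [X in _ = X]mxE => ->.
by rewrite addr0.
Qed.

(** The equations of the space of periods, completed to a coordinate system,
    are variables that suffice: the cokernel of M supplies the equations, and
    its extended column basis the change of variables. *)
Lemma representable_corank Q A (M : 'M_m) : (forall x, Q x = qf A (coords x)) ->
  (forall x, (x \in singrad A) = (x <= M)%MS) -> representable Q (m - \rank M).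
Proof.
move=> QA SM; set r := (m - _)%N; pose K := cokermx M.
have rK : \rank K = r by rewrite mxrank_coker.
pose P := col_ebase K; have uP : P \in unitmx by apply: col_ebase_unit.
pose I := pid_mx r : 'M[F]_m.
have II : I *m I = I by rewrite pid_mx_id // leq_subr.
pose B := invmx P *m A *m (invmx P)^T; pose C := I *m B *m I^T.
(* Truncating to the first r new coordinates changes u by a period. *)
have CE u : qf A u = qf C (u *m P).
  have -> : qf C (u *m P) = qf A (u *m P *m I *m invmx P).
    by rewrite /qf /C /B !trmx_mul !mulmxA.
  set v := (u *m P *m I *m invmx P).
  have : u - v \in singrad A.
    rewrite SM submxE.
    have uv0 : (u - v) *m P *m I = 0.
      by rewrite mulmxBl /v mulmxKV // mulmxBl -[_ *m I *m I]mulmxA II subrr.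
    have -> : cokermx M = P *m I *m row_ebase K by rewrite /I -rK mulmx_ebase.
    by rewrite !mulmxA uv0 mul0mx.
  by rewrite inE => /forallP/(_ v)/eqP; rewrite addrC subrK.
have C0 i j : C i j != 0 -> (i < r)%N && (j < r)%N.
  apply: contraNT; rewrite negb_and => /orP[ir|jr].
    rewrite /C -mulmxA mxE big1 // => k _.
    by rewrite mxE (negPf ir) andbF mul0r.
  by rewrite mxE big1 // => k _; rewrite !mxE (negPf (_ : ~~ ((j == k :> nat) && (j < r)%N))) ?mulr0 // negb_and jr orbT.
exists P, (\sum_i \sum_j C i j *: ('X_i * 'X_j)); split=> //.
- apply: rpred_sum => i _; apply: rpred_sum => j _; apply: dhomogZ.
  by apply: (@dhomogM _ _ _ 1 _ 1); rewrite dhomogX; apply/eqP/mdeg1.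
- move=> mon /msupp_sum_le/flatten_mapP[i _] /msupp_sum_le/flatten_mapP[j _].
  have [->|/C0/andP[ir jr]] := eqVneq (C i j) 0; first by rewrite scale0r msupp0.
  move/msuppZ_le; rewrite -mpolyXD msuppX inE => /eqP -> k.
  by rewrite mnmDE !mnm1E; have [<-|_] := eqVneq i k => //; have [<-|_] := eqVneq j k.
- move=> x; rewrite QA CE.
  rewrite raddf_sum /= /qf mxE; under [RHS]eq_bigr => i _ do rewrite raddf_sum.
  rewrite [RHS]exchange_big /=; apply: eq_bigr => j _.
  rewrite [in LHS]mxE mulr_suml; apply: eq_bigr => i _.
  by rewrite mevalZ mevalM !mevalXU [_^T _ _]mxE; ring.
Qed.

Lemma qrankE Q A (M : 'M_m) : (forall x, Q x = qf A (coords x)) ->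
  (forall x, (x \in singrad A) = (x <= M)%MS) -> qrank Q = (m - \rank M)%N.
Proof.
move=> QA SM; set r := (m - _)%N.
have rm : (r <= m)%N by apply: leq_subr.
have Hr : representable Q r by apply: representable_corank SM.
set a := fun r => `[< representable Q r >].
have nthr k : (k <= m)%N -> nth 0%N (iota 0 m.+1) k = k.
  by move=> km; rewrite nth_iota.
have Ha : has a (iota 0 m.+1).
  by apply/hasP; exists r; [rewrite mem_iota | apply/asboolP].
have fm : (qrank Q <= m)%N.
  by rewrite -ltnS; move: Ha; rewrite has_find size_iota.
have := nth_find 0%N Ha; rewrite -/(qrank Q) nthr // => /asboolP.
move=> /(representable_le QA fm); rewrite (card_submx SM) leq_exp2l ?finNzRing_gt1 // => le1.
apply/eqP; rewrite eqn_leq; apply/andP; split.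
  rewrite leqNgt; apply/negP => /(before_find 0%N); rewrite nthr // => /negP; apply.
  exact/asboolP.
by move: le1; rewrite /r; lia.
Qed.

Lemma qrank_le Q A : (forall x, Q x = qf A (coords x)) -> (qrank Q <= m)%N.
Proof. by move=> QA; have [M SM] := singrad_mx A; rewrite (qrankE QA SM) leq_subr. Qed.

Lemma even_rank_fibers Q A : (forall x, Q x = qf A (coords x)) -> ~~ odd (qrank Q) ->
  exists2 eps : int, eps = 1 \/ eps = -1 &
    forall c, #|[set x : finvect_type L | Q x == c]|%:Z = q%:Z ^+ (m - 1)
       + eps * (if c == 0 then q%:Z - 1 else - 1) * q%:Z ^+ (m - (qrank Q)./2 - 1).
Proof.
move=> QA; have [M SM] := singrad_mx A; rewrite (qrankE QA SM) => ev.
have [eps He Hc] := even_rank_count dim_gt0 SM ev; exists eps => // c.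
rewrite -Hc; congr Posz; rewrite /qcount -(card_imset _ (can_inj (@coordsK : cancel (_ : finvect_type L -> _) _))).
apply: eq_card => y; rewrite inE; apply/imsetP/idP => [[x]|yc].
  by rewrite inE QA => xc ->.
by exists (uncoords y); rewrite ?uncoordsK // inE QA uncoordsK.
Qed.

End Rank.

(** * Frobenius powers and the trace *)
Section Trace.
Variables (F : finFieldType) (L : splittingFieldType F).
Local Notation q := #|F|.
Local Notation m := (\dim {:L}).
Implicit Types (x y z : L) (c : F).

Lemma card_ext : #|finvect_type L| = (q ^ m)%N.
Proof.
have bij : bijective (@coords F L : finvect_type L -> 'rV_m).
  by exists (passmx.vecof (vbasis {:L})); [exact: coordsK | exact: uncoordsK].
by rewrite (bij_eq_card bij) card_mx mul1n.
Qed.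

(** The q-power map is realized as an element of the Galois group: its linearity
    over F is then free, and the trace becomes a sum over its iterates. *)
Lemma frob_gen : {sigma : gal_of {:L} |
  generator 'Gal({:L} / 1) sigma & forall x, sigma x = x ^+ q}.
Proof.
have [sigma gen H] := finField_galois_generator (sub1v {:L}%AS).
by exists sigma => // x; rewrite H ?memvf // dimv1 expn1.
Qed.

Lemma frobX (sigma : gal_of {:L}) k x : (forall x, sigma x = x ^+ q) ->
  (sigma ^+ k)%g x = x ^+ (q ^ k).
Proof.
move=> Hs; elim: k => [|k IHk]; first by rewrite expg0 gal_id expn0 expr1.
by rewrite expgSr galM ?memvf // IHk Hs expnSr exprM.
Qed.

Lemma frobP k c x y : (c *: x + y) ^+ (q ^ k) = c *: x ^+ (q ^ k) + y ^+ (q ^ k).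
Proof. by have [sigma _ Hs] := frob_gen; rewrite -!(frobX _ _ Hs) linearP. Qed.

Lemma frob_dim x : x ^+ (q ^ m) = x.
Proof. by have := @expf_card (finvect_type L) x; rewrite card_ext. Qed.

Lemma TrE x : (Tr x)%:A = \sum_(j < m) x ^+ (q ^ j).
Proof.
have galL : galois 1%AS {:L}%AS by apply: finField_galois; apply: sub1v.
have -> : (Tr x)%:A = galTrace 1%AS {:L}%AS x.
  have : galTrace 1%AS {:L}%AS x \in <<[tuple (1%R : L)]>>%VS.
    by rewrite span_seq1; apply: mem_galTrace; rewrite ?memvf.
  by move/coord_span => ->; rewrite big_ord1.
have [sigma /eqP gen Hs] := frob_gen.
have os : #[sigma]%g = m.
  by rewrite orderE -gen -galois_dim // dimv1 divn1.
pose h (j : 'I_m) := (sigma ^+ j)%g.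
have hi : injective h.
  move=> i j /eqP; rewrite eq_expg_mod_order os !modn_small // => /eqP.
  exact: val_inj.
rewrite /galTrace (eq_bigl (fun g => g \in [set h j | j : 'I_m])).
  by rewrite big_imset /=; [apply: eq_bigr => j _; rewrite frobX | move=> i j _ _ /hi].
move=> g; rewrite gen; apply/idP/imsetP => [/cyclePmin[i]|[j _ ->]]; last exact: mem_cycle.
by rewrite os => im ->; exists (Ordinal im).
Qed.

Lemma in_algI : injective (fun c : F => c%:A : L).
Proof. by move=> c d /(fmorph_inj (in_alg L)). Qed.

Lemma Tr_linear c x y : Tr (c *: x + y) = c * Tr x + Tr y.
Proof.
apply: in_algI; rewrite scalerDl -scalerA !TrE scaler_sumr -big_split /=.
by apply: eq_bigr => j _; rewrite frobP.
Qed.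

Lemma TrD x y : Tr (x + y) = Tr x + Tr y.
Proof. by have := Tr_linear 1 x y; rewrite scale1r mul1r. Qed.

Lemma Tr0 : Tr (0 : L) = 0.
Proof. by have := Tr_linear (-1) 0 0; rewrite scaler0 addr0 mulN1r addNr. Qed.

Lemma TrZ c x : Tr (c *: x) = c * Tr x.
Proof. by have := Tr_linear c x 0; rewrite addr0 Tr0 addr0. Qed.

Lemma Tr_sum (I : finType) (f : I -> L) : Tr (\sum_i f i) = \sum_i Tr (f i).
Proof. exact: (big_morph _ TrD Tr0). Qed.

Lemma Tr_frob k x : Tr (x ^+ (q ^ k)) = Tr x.
Proof.
elim: k => [|k <-]; first by rewrite expn0 expr1.
rewrite expnSr exprM; set y := x ^+ _; apply: in_algI; rewrite !TrE.
have := frob_dim y; have := dim_gt0 L; case: m => // n _ yn.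
rewrite big_ord_recr [RHS]big_ord_recl /= -exprM -expnS yn addrC; congr (_ + _).
by apply: eq_bigr => j _; rewrite -exprM -expnS.
Qed.

Lemma poly_vanish (p : {poly L}) :
  (size p <= q ^ m)%N -> (forall x, p.[x] = 0) -> p = 0.
Proof.
move=> sp p0; apply/eqP; apply: contraTT sp => pn0; rewrite -ltnNge.
rewrite -card_ext cardE.
apply: (@max_poly_roots L p (enum (finvect_type L)) pn0); last exact: enum_uniq.
by apply/allP => x _; rewrite /root p0.
Qed.

(** Otherwise the trace would vanish identically, although it is given by a nonzero
    polynomial of degree less than q^m. *)
Lemma Tr_nondegenerate z : (forall y, Tr (y * z) = 0) -> z = 0.
Proof.
move=> H; apply/eqP; apply: contraT => z0.
have Tr00 x : Tr x = 0 by rewrite -[x](divfK z0) H.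
pose p : {poly L} := \sum_(j < m) 'X^(q ^ j).
have p0 : p = 0.
  apply: poly_vanish => [|x].
    apply: (leq_trans (size_sum _ _ _)); apply/bigmax_leqP => j _.
    by rewrite size_polyXn ltn_exp2l ?finNzRing_gt1.
  by rewrite horner_sum; under eq_bigr => j _ do rewrite hornerXn; rewrite -TrE Tr00 scale0r.
(* The coefficient of degree 1 = q^0 comes from the term j = 0 alone. *)
have := congr1 (fun r : {poly L} => r`_1) p0; rewrite coef0 coef_sum.
rewrite (bigD1 (Ordinal (dim_gt0 L))) //= expn0 coefXn eqxx big1 ?addr0 => [/eqP|j j0].
  by rewrite oner_eq0.
rewrite coefXn -[1%N in X in X == _](expn0 q) eqn_exp2l ?finNzRing_gt1 //.
by rewrite eq_sym (negPf (_ : j != 0%N :> nat)).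
Qed.

End Trace.

Lemma increasing_inj s (f : 'I_s -> nat) :
  (forall i j : 'I_s, (i < j)%N -> (f i < f j)%N) -> injective f.
Proof.
move=> f_incr i j E; apply: val_inj; apply/eqP; rewrite eqn_leq.
by apply/andP; split; rewrite leqNgt; apply/negP => /f_incr; rewrite E ltnn.
Qed.

Lemma half_codim_gt0 d r : (2 < d -> r <= d -> d - r./2 - 1 = (d - r./2 - 2).+1)%N.
Proof.
move=> d2 rd; have := odd_double_half r; rewrite -muln2.
by move: (nat_of_bool _) r./2 => b h; lia.
Qed.

(** * The forms of the family *)
Section TraceForms.
Variables (F : finFieldType) (L : splittingFieldType F).
Local Notation q := #|F|.
Local Notation m := (\dim {:L}).
Variables (s : nat) (ell : 'I_s -> nat).
Implicit Types (a : {ffun 'I_s -> finvect_type L}) (x y : L).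

Lemma lin_poly_horner a x : (lin_poly ell a).[x] = \sum_i (a i : L) * x ^+ (q ^ ell i).
Proof.
by rewrite /lin_poly horner_sum; apply: eq_bigr => i _; rewrite hornerZ hornerXn.
Qed.

Lemma lin_poly_hornerP a c x y :
  (lin_poly ell a).[c *: x + y] = c *: (lin_poly ell a).[x] + (lin_poly ell a).[y].
Proof.
rewrite !lin_poly_horner scaler_sumr -big_split; apply: eq_bigr => i _ /=.
by rewrite frobP mulrDr scalerAr.
Qed.

Lemma qform_mx a : exists A : 'M[F]_m,
  forall x, qform (lin_poly ell a) x = qf A (coords x).
Proof.
set R := lin_poly ell a; pose e i := (vbasis {:L})`_i.
exists (\matrix_(i < m, j < m) Tr (e i * R.[e j])) => x.
have R0 : R.[0] = 0.
  by have := lin_poly_hornerP a (-1) 0 0; rewrite scaler0 addr0 scaleN1r addNr.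
have RS (f : 'I_m -> F) : R.[ \sum_i f i *: e i] = \sum_i f i *: R.[e i].
  apply: (big_ind2 (fun u v => R.[u] = v)) => // [u u' v v' Hu Hv|i _].
    by have := lin_poly_hornerP a 1 u v; rewrite !scale1r -/R Hu Hv.
  by have := lin_poly_hornerP a (f i) (e i) 0; rewrite addr0 -/R R0 addr0.
rewrite -[x in LHS]coordsK /passmx.vecof /qform RS mulr_suml Tr_sum.
rewrite /qf mxE; under [RHS]eq_bigr => j _ do rewrite mxE mulr_suml.
rewrite [RHS]exchange_big /=; apply: eq_bigr => i _.
rewrite mulr_sumr Tr_sum; apply: eq_bigr => j _.
by rewrite -scalerAl -scalerAr !TrZ [in RHS]mxE [_^T _ _]mxE -/(e i); ring.
Qed.

Hypothesis ell_ge1 : forall i : 'I_s, (1 <= ell i)%N.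
Hypothesis ell_inj : injective ell.
Hypothesis ell_lt : forall i : 'I_s, (2 * ell i < m)%N.

(** Since Tr(x a y^(q^l)) = Tr(y (a x)^(q^(m-l))), the polar form of
    Q_R is Tr(y H(x)) with H this polynomial. *)
Definition polar_poly a : {poly L} :=
  \sum_(i < s) ((a i : L) *: 'X^(q ^ ell i) + (a i : L) ^+ (q ^ (m - ell i)) *: 'X^(q ^ (m - ell i))).

Lemma qform_polar a x y :
  qform (lin_poly ell a) (x + y) =
  qform (lin_poly ell a) x + qform (lin_poly ell a) y + Tr (y * (polar_poly a).[x]).
Proof.
have -> : qform (lin_poly ell a) (x + y) = qform (lin_poly ell a) x + qform (lin_poly ell a) y
   + (Tr (y * (lin_poly ell a).[x]) + Tr (x * (lin_poly ell a).[y])).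
  rewrite /qform; have := lin_poly_hornerP a 1 x y; rewrite !scale1r => ->.
  by rewrite mulrDl !mulrDr !TrD; ring.
congr (_ + _); rewrite !lin_poly_horner /polar_poly horner_sum !mulr_sumr !Tr_sum -big_split.
apply: eq_bigr => i _ /=; rewrite hornerD !hornerZ !hornerXn mulrDr TrD; congr (_ + _).
rewrite -[LHS](Tr_frob (m - ell i)) !exprMn -exprM -expnD.
have -> : (ell i + (m - ell i) = m)%N by have := ell_lt i; lia.
by rewrite frob_dim; congr Tr; ring.
Qed.

(** The exponents l and m - l are pairwise distinct because 0 < 2 l < m, so the
    coefficients a_i can be read off [polar_poly], which vanishes by
    nondegeneracy of the trace. *)
Lemma qform_eq0 a : (forall x, qform (lin_poly ell a) x = 0) -> a = 0.
Proof.
move=> Q0; have q1 := finNzRing_gt1 F.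
have H0 : polar_poly a = 0.
  apply: poly_vanish => [|x].
    apply: (leq_trans (size_sum _ _ _)); apply/bigmax_leqP => i _.
    have := ell_lt i; have := ell_ge1 i => l1 l2.
    apply: (leq_trans (size_polyD _ _)); rewrite geq_max; apply/andP; split;
      apply: (leq_trans (size_scale_leq _ _)); rewrite size_polyXn ltn_exp2l //; lia.
  by apply: Tr_nondegenerate => y; have := qform_polar a x y; rewrite !Q0 !add0r.
apply/ffunP => i; rewrite ffunE.
have := congr1 (fun r : {poly L} => r`_(q ^ ell i)) H0; rewrite coef0 coef_sum.
rewrite (bigD1 i) //= big1 => [|k ki].
  rewrite addr0 coefD !coefZ !coefXn eqxx eqn_exp2l //.
  have -> : (ell i == m - ell i)%N = false by have := ell_lt i; lia.
  by rewrite mulr1 mulr0 addr0.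
rewrite coefD !coefZ !coefXn !eqn_exp2l //.
have -> : (ell i == ell k) = false by rewrite (inj_eq ell_inj) eq_sym (negPf ki).
have -> : (ell i == m - ell k)%N = false.
  by have := ell_lt i; have := ell_lt k; lia.
by rewrite !mulr0 addr0.
Qed.

Lemma qform0 a : qform (lin_poly ell a) 0 = 0.
Proof. by rewrite /qform mul0r Tr0. Qed.

(** If c is nonzero, 0 is the only zero of the form.  But the number of zeros
    given by [even_rank_fibers] is divisible by q once m >= 3, which the
    conditions on the exponents imply when a is nonzero. *)
Lemma qform_const a c : ~~ odd (qrank (qform (lin_poly ell a))) ->
  (forall x, x != 0 -> qform (lin_poly ell a) x = c) -> a = 0 /\ c = 0.
Proof.
move=> ev Qc.
have [c0|c0] := eqVneq c 0.
  split=> //; apply: qform_eq0 => x; have [->|x0] := eqVneq x 0; first exact: qform0.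
  by rewrite Qc.
have [a0|] := eqVneq a 0.
  split=> //; rewrite -(Qc 1) ?oner_eq0 // /qform lin_poly_horner a0.
  by rewrite big1 ?mulr0 ?Tr0 // => i _; rewrite ffunE mul0r.
move=> an0; have [i _] : exists i, a i != 0.
  apply/existsP; apply: contraNT an0; rewrite negb_exists => /forallP H.
  by apply/eqP/ffunP => i; rewrite ffunE; apply/eqP; have := H i; rewrite negbK.
have l1 := ell_ge1 i; have l2 := ell_lt i.
have [A QA] := qform_mx a; have rm := qrank_le QA.
have [eps _ /(_ 0)] := even_rank_fibers QA ev; rewrite eqxx.
have -> : #|[set x : finvect_type L | qform (lin_poly ell a) x == 0]| = 1%N.
  rewrite -(cards1 (0 : finvect_type L)); apply: eq_card => x; rewrite !inE.
  by have [->|x0] := eqVneq x 0; rewrite ?qform0 ?eqxx // Qc // (negPf c0).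
set r := qrank _ in ev rm *.
have -> : q%:Z ^+ (m - 1) = q%:Z * q%:Z ^+ (m - 2).
  by rewrite -exprS; congr (_ ^+ _); lia.
have -> : q%:Z ^+ (m - r./2 - 1) = q%:Z * q%:Z ^+ (m - r./2 - 2).
  by rewrite -exprS; congr (_ ^+ _); apply: half_codim_gt0 => //; lia.
move=> E.
have : (q %| 1)%Z.
  by rewrite E; apply: rpredD; [exact: dvdz_mulr | apply: dvdz_mull; exact: dvdz_mulr].
by rewrite dvdzE /= dvdn1; have := finNzRing_gt1 F; case: q => [|[]].
Qed.

End TraceForms.

(** * Counting through injections; dimension from cardinality *)
Section FinsetImage.

Lemma card_image_filter (T : finType) (K : choiceType) (f : T -> K) (A : {fset K}) (P : pred K) :
  injective f -> (forall c, (c \in A) = [exists t, c == f t]) ->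
  #|` [fset c in A | P c]%fset | = #|[set t | P (f t)]|.
Proof.
move=> fi AE.
have -> : [fset c in A | P c]%fset = [fset f t | t in [set t | P (f t)]]%fset.
  apply/fsetP => c; rewrite !inE AE; apply/andP/imfsetP => /= [[/existsP[t /eqP->] Pt]|[t]].
    by exists t; rewrite // inE.
  by rewrite inE => Pt ->; split=> //; apply/existsP; exists t.
by rewrite card_imfset //= -cardE.
Qed.

Lemma sum_indicator (T : eqType) (s : seq T) (x : T) (G : T -> nat) :
  uniq s -> x \in s -> (\sum_(y <- s) (x == y) * G y = G x)%N.
Proof.
move=> us xs; rewrite (bigD1_seq x) //= eqxx mul1n big1 ?addn0 // => y yx.
by rewrite eq_sym (negPf yx).
Qed.

End FinsetImage.

Section Dimension.
Variables (F : finFieldType) (n : nat).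

(** The dimension is read off the cardinal, so that dimensions of codes reduce
    to injectivity of the encoding. *)
Lemma has_dimension_card (C : {fset 'rV[F]_n}) k : 0 \in C ->
  (forall a c d, c \in C -> d \in C -> a *: c + d \in C) ->
  #|` C| = (#|F| ^ k)%N -> has_dimension C k.
Proof.
move=> C0 CD cC; pose V := <<enum_fset C>>%VS.
have VC c : (c \in V) = (c \in C).
  apply/idP/idP => [|cC']; last exact: memv_span.
  rewrite /V -[enum_fset C]/(tval (in_tuple (enum_fset C))) => /coord_span ->.
  apply: (big_ind (fun d => d \in C)) => // [d e dC eC|i _].
    by rewrite -[d]scale1r CD.
  by rewrite -[_ *: _]addr0 CD // mem_nth.
exists V => //.
apply/eqP; rewrite -(eqn_exp2l _ _ (finNzRing_gt1 F)) -cC; apply/eqP.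
have := @card_vspace F 'rV[F]_n _ V => <-.
rewrite cardE; apply/perm_size/uniq_perm; rewrite ?enum_uniq ?fset_uniq // => c.
by rewrite mem_enum VC.
Qed.

End Dimension.

(** * Codewords, weights and their distribution *)
Section Codewords.
Variables (F : finFieldType) (L : splittingFieldType F).
Local Notation q := #|F|.
Local Notation m := (\dim {:L}).
Local Notation n := (q ^ m - 1)%N.
Variables (s : nat) (ell : 'I_s -> nat).
Hypothesis ell_ge1 : forall i : 'I_s, (1 <= ell i)%N.
Hypothesis ell_inj : injective ell.
Hypothesis ell_lt : forall i : 'I_s, (2 * ell i < m)%N.
Variable alpha : L.
Hypothesis alpha_prim : n.-primitive_root alpha.
Hypothesis even_fam : even_rank_family (lin_family L ell).

Local Notation idx := {ffun 'I_s -> finvect_type L}.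
Local Notation fam := (lin_family L ell).
Local Notation Qf a := (qform (lin_poly ell a)).
Local Notation cw a b := (codeword alpha (lin_poly ell a) b).
Implicit Types (a : idx) (b : F).

Lemma in_fam R : (R \in fam) = [exists a, R == lin_poly ell a].
Proof.
apply/imfsetP/existsP => /= [[a _ ->]|[a /eqP->]]; by exists a.
Qed.

Lemma even_Qf a : ~~ odd (qrank (Qf a)).
Proof. by apply: even_fam; rewrite in_fam; apply/existsP; exists a. Qed.

Lemma n_gt0 : (0 < n)%N.
Proof. exact: prim_order_gt0 alpha_prim. Qed.

Lemma expn_dim : (q ^ m = n.+1)%N.
Proof. by rewrite subn1 prednK // expn_gt0 (ltnW (finNzRing_gt1 F)). Qed.

Lemma nonzero_power (x : L) : x != 0 -> exists j : 'I_n, x = alpha ^+ j.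
Proof.
move=> x0; have [|j ->] := @prim_rootP _ _ _ alpha_prim x; last by exists j.
by apply: (mulfI x0); rewrite -exprS -expn_dim frob_dim mulr1.
Qed.

Lemma alpha_neq0 : alpha != 0.
Proof.
apply/eqP => a0; have := prim_expr_order alpha_prim.
by rewrite a0 expr0n eqn0Ngt n_gt0 => /eqP; rewrite eq_sym oner_eq0.
Qed.

Lemma lin_poly_inj : injective (@lin_poly F L s ell).
Proof.
move=> a a' E; apply/ffunP => i.
have cE (d : idx) : (lin_poly ell d)`_(q ^ ell i) = d i.
  rewrite /lin_poly coef_sum (bigD1 i) //= big1 => [|k ki].
    by rewrite coefZ coefXn eqxx mulr1 addr0.
  rewrite coefZ coefXn eqn_exp2l ?finNzRing_gt1 // (inj_eq ell_inj) eq_sym (negPf ki).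
  by rewrite mulr0.
by rewrite -!cE E.
Qed.

Lemma lin_poly0 : lin_poly ell (0 : idx) = 0.
Proof. by rewrite /lin_poly big1 // => i _; rewrite ffunE scale0r. Qed.

Lemma qform_linear (k : F) a a' x :
  Qf [ffun i => k *: a i + a' i] x = k * Qf a x + Qf a' x.
Proof.
rewrite /qform -Tr_linear !lin_poly_horner scalerAr scaler_sumr -mulrDr -big_split.
by congr (Tr (_ * _)); apply: eq_bigr => i _; rewrite ffunE /= scalerAl -mulrDl.
Qed.

Lemma cw_linear k a a' b b' :
  cw [ffun i => k *: a i + a' i] (k * b + b') = k *: cw a b + cw a' b'.
Proof. by apply/rowP => j; rewrite !mxE qform_linear; ring. Qed.

Lemma cw_eq0 a b : cw a b = 0 -> a = 0 /\ b = 0.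
Proof.
move=> E.
have H x : x != 0 -> Qf a x = - b.
  case/nonzero_power => j ->; have /rowP/(_ j) := E; rewrite !mxE => /eqP.
  by rewrite addr_eq0 => /eqP.
have [-> /eqP] := qform_const ell_ge1 ell_inj ell_lt (even_Qf a) H.
by rewrite oppr_eq0 => /eqP.
Qed.

Lemma cw_inj a a' b b' : cw a b = cw a' b' -> a = a' /\ b = b'.
Proof.
move=> E; have := cw_linear (-1) a a' b b'.
rewrite E scaleN1r addNr => /cw_eq0[/ffunP Ha Hb]; split.
  apply/ffunP => i; have := Ha i; rewrite !ffunE scaleN1r addrC => /eqP.
  by rewrite subr_eq0 => /eqP.
by move/eqP: Hb; rewrite mulN1r addrC subr_eq0 => /eqP.
Qed.

Lemma in_code (c : 'rV[F]_n) : (c \in code alpha fam) = [exists a, c == cw a 0].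
Proof.
apply/imfsetP/existsP => /= [[R]|[a /eqP->]].
  by rewrite in_fam => /existsP[a /eqP->] ->; exists a.
by exists (lin_poly ell a) => //; rewrite in_fam; apply/existsP; exists a.
Qed.

Lemma in_code0 (c : 'rV[F]_n) : (c \in code0 alpha fam) = [exists t : idx * F, c == cw t.1 t.2].
Proof.
apply/imfset2P/existsP => /= [[R + [b _ ->]]|[[a b] /eqP->]].
  by rewrite in_fam => /existsP[a /eqP->]; exists (a, b).
exists (lin_poly ell a); first by rewrite in_fam; apply/existsP; exists a.
by exists b.
Qed.

(** Shifting amounts to substituting alpha x for x in x R(x). *)
Lemma cw_shift a b : exists a', \row_j (cw a b) 0 (ordS j) = cw a' b.
Proof.
exists [ffun i => (alpha ^+ (q ^ ell i).+1 * a i : L)]; apply/rowP => j; rewrite !mxE.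
congr (_ + _); rewrite /= (prim_expr_mod alpha_prim) exprS /qform !lin_poly_horner.
congr Tr; rewrite !mulr_sumr; apply: eq_bigr => i _.
by rewrite ffunE exprMn exprS; ring.
Qed.

Lemma card_idx : #|{: idx}| = (q ^ (m * s))%N.
Proof. by rewrite card_ffun card_ord card_ext expnM. Qed.

Lemma code_cyclic : cyclic_code (code alpha fam).
Proof.
move=> c; rewrite !in_code => /existsP[a /eqP->].
by have [a' ->] := cw_shift a 0; apply/existsP; exists a'.
Qed.

Lemma code0_cyclic : cyclic_code (code0 alpha fam).
Proof.
move=> c; rewrite !in_code0 => /existsP[[a b] /eqP->].
by have [a' ->] := cw_shift a b; apply/existsP; exists (a', b).
Qed.

Lemma cw00 : cw 0 0 = 0.
Proof.
by apply/rowP => j; rewrite !mxE lin_poly0 /qform horner0 mulr0 Tr0 addr0.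
Qed.

Lemma wt0 : wt (0 : 'rV[F]_n) = 0%N.
Proof. by apply/eqP; rewrite cards_eq0; apply/eqP/setP => j; rewrite !inE mxE eqxx. Qed.

Lemma card_filter_code (P : pred 'rV[F]_n) :
  #|` [fset c in code alpha fam | P c]%fset | = #|[set a | P (cw a 0)]|.
Proof.
by apply: (card_image_filter _ (f := fun a => cw a 0)) => [a a' /cw_inj[]|]; last exact: in_code.
Qed.

Lemma card_filter_code0 (P : pred 'rV[F]_n) :
  #|` [fset c in code0 alpha fam | P c]%fset | = #|[set t : idx * F | P (cw t.1 t.2)]|.
Proof.
apply: (card_image_filter _ (f := fun t : idx * F => cw t.1 t.2)); last exact: in_code0.
by move=> [a b] [a' b'] /cw_inj[/= -> ->].
Qed.

Lemma code_dimension : has_dimension (code alpha fam) (m * s).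
Proof.
apply: has_dimension_card.
- by rewrite in_code; apply/existsP; exists 0; rewrite cw00.
- move=> k c d; rewrite !in_code => /existsP[a /eqP->] /existsP[a' /eqP->].
  apply/existsP; exists [ffun i => k *: a i + a' i].
  by rewrite -cw_linear mulr0 addr0.
have := card_filter_code predT; rewrite cardsE card_idx => <-.
by congr (#|` _|); apply/fsetP => c; rewrite !inE andbT.
Qed.

Lemma code0_dimension : has_dimension (code0 alpha fam) (m * s + 1).
Proof.
apply: has_dimension_card.
- by rewrite in_code0; apply/existsP; exists (0, 0); rewrite cw00.
- move=> k c d; rewrite !in_code0 => /existsP[[a b] /eqP->] /existsP[[a' b'] /eqP->].
  apply/existsP; exists ([ffun i => k *: a i + a' i], k * b + b').
  by rewrite -cw_linear.
have := card_filter_code0 predT; rewrite cardsE card_prod card_idx -expnSr addn1 => <-.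
by congr (#|` _|); apply/fsetP => c; rewrite !inE andbT.
Qed.

(** The powers of alpha run through all nonzero x; the value 0 of the form at
    x = 0 accounts for the last term. *)
Lemma wt_cw a b : (wt (cw a b))%:Z =
  (q ^ m)%N%:Z - #|[set x : finvect_type L | Qf a x == - b]|%:Z - (b != 0)%:Z.
Proof.
set Z := [set x | _].
have -> : wt (cw a b) = #|~: (Z :|: [set (0 : finvect_type L)])|.
  pose f (j : 'I_n) : finvect_type L := alpha ^+ j.
  have fi : injective f.
    move=> i j /eqP; rewrite (eq_prim_root_expr alpha_prim) !modn_small // => /eqP.
    exact: val_inj.
  rewrite /wt -(card_imset _ fi); apply: eq_card => x.
  rewrite !inE negb_or; apply/imsetP/andP => [[j]|[xb x0]].
    by rewrite inE mxE addr_eq0 => Hj ->; split=> //; rewrite /f expf_neq0 // alpha_neq0.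
  have [j xj] := nonzero_power x0; exists j => //.
  by rewrite inE mxE addr_eq0 -xj.
rewrite cardsCs setCK card_ext -subzn; last by rewrite -card_ext max_card.
rewrite -addrA -opprD -PoszD; congr (_ - Posz _).
by rewrite setUC cardsU1 inE qform0 [_ == - b]eq_sym oppr_eq0 addnC.
Qed.

Definition weightW (r i : nat) : int :=
  q%:Z ^+ m - q%:Z ^+ (m - 1) + (-1) ^+ i * (q%:Z - 1) * q%:Z ^+ (m - r./2 - 1).
Definition weightW0 (r i : nat) : int :=
  q%:Z ^+ m - q%:Z ^+ (m - 1) + (-1) ^+ i.+1 * q%:Z ^+ (m - r./2 - 1) - 1.

Definition qtype a : nat := if type1 (Qf a) then 1 else 2.

(** The exponent turns the types 1 and 2 of a table row into the signs 1 and
    -1. *)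
Lemma qform_fibers a : exists2 eps : int, eps = (-1) ^+ (qtype a).+1 &
    type3 (Qf a) = ~~ type1 (Qf a) /\
    forall c, #|[set x : finvect_type L | Qf a x == c]|%:Z = q%:Z ^+ (m - 1)
       + eps * (if c == 0 then q%:Z - 1 else - 1) * q%:Z ^+ (m - (qrank (Qf a))./2 - 1).
Proof.
have [A QA] := qform_mx ell a.
have [eps He Hc] := even_rank_fibers QA (even_Qf a).
have signE e : has_sign e (Qf a) = (e == eps).
  rewrite /has_sign even_Qf /= /zeros Hc eqxx !PoszX (inj_eq (addrI _)).
  have q1 : q%:Z - 1 != 0.
    by rewrite subr_eq0; have := finNzRing_gt1 F; case: #|F| => [|[]].
  have q0 k : q%:Z ^+ k != 0.
    by rewrite expf_neq0 // -lt0n (ltnW (finNzRing_gt1 F)).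
  by rewrite (inj_eq (mulIf (q0 _))) (inj_eq (mulIf q1)) eq_sym.
exists eps; last by split=> //; rewrite /type1 /type3 !signE; case: He => ->.
by rewrite /qtype /type1 signE; case: He => ->.
Qed.

Lemma wt_cw0 a : (wt (cw a 0))%:Z = weightW (qrank (Qf a)) (qtype a).
Proof.
rewrite wt_cw; have [eps -> [_ ->]] := qform_fibers a.
rewrite oppr0 !eqxx subr0 /weightW PoszX [(-1) ^+ _.+1]exprS.
by move: (_ ^+ m) (_ ^+ (m - 1)) (_ ^+ (m - _ - 1)) (_ ^+ qtype a) => A B C e; ring.
Qed.

Lemma wt_cw_neq0 a b : b != 0 -> (wt (cw a b))%:Z = weightW0 (qrank (Qf a)) (qtype a).
Proof.
move=> b0; rewrite wt_cw; have [eps -> [_ ->]] := qform_fibers a.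
rewrite oppr_eq0 (negPf b0) /= /weightW0 PoszX.
by move: (_ ^+ m) (_ ^+ (m - 1)) (_ ^+ (m - _ - 1)) (_ ^+ _.+1) => A B C e; ring.
Qed.

Lemma MnumE r i : i \in [:: 1%N; 2%N] ->
  Mnum fam r i = #|[set a : idx | [&& a != 0, qrank (Qf a) == r & qtype a == i]]|.
Proof.
move=> i12; rewrite /Mnum (card_image_filter _ lin_poly_inj in_fam).
apply: eq_card => a; rewrite !inE -{1}lin_poly0 (inj_eq lin_poly_inj).
congr [&& _, _ & _]; have [_ _ [t3 _]] := qform_fibers a; rewrite t3 /qtype.
by move: i12; rewrite !inE => /orP[]/eqP ->; case: (type1 _).
Qed.

(** Each nonzero R contributes to exactly one row of the table: its rank
    is among [ranks fam] and it has exactly one of the two types. *)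
Lemma table_sum (W M : nat -> nat -> _) k w :
  (forall r i, M r i = (Mnum fam r i * k)%N) ->
  (\sum_(t <- [seq (W r i : int, M r i) | r <- ranks fam, i <- [:: 1%N; 2%N]] | t.1 == w) t.2
    = #|[set a : idx | (a != 0%R) && (W (qrank (Qf a)) (qtype a) == w)]| * k)%N.
Proof.
move=> MM; rewrite big_mkcond big_allpairs_dep /=.
transitivity (\sum_(r <- ranks fam) \sum_(i <- [:: 1%N; 2%N]) \sum_(a : idx)
   (qrank (Qf a) == r) * ((qtype a == i) * (((a != 0%R) && (W r i == w)) * k)))%N.
  apply: eq_bigr => r _; apply: eq_big_seq => i i12.
  rewrite MM MnumE // -sum1_card big_mkcond big_distrl /=.
  case: eqP => _; last by rewrite big1 // => a _; rewrite andbF !muln0.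
  apply: eq_bigr => a _; rewrite inE andbT.
  by case: (a != 0); case: (qrank _ == r); case: (qtype a == i); rewrite /= ?muln0 ?mul0n ?mul1n.
under eq_bigr => r _ do rewrite exchange_big.
rewrite exchange_big /= -sum1_card big_distrl [RHS]big_mkcond /=.
apply: eq_bigr => a _; under eq_bigr => r _ do rewrite -big_distrr.
rewrite sum_indicator ?fset_uniq //; last first.
  by apply/imfsetP; exists (lin_poly ell a) => //=; rewrite in_fam; apply/existsP; exists a.
rewrite sum_indicator //; last by rewrite /qtype; case: (type1 _).
by rewrite inE; case: (_ && _).
Qed.

Lemma code_weights : weight_distribution (code alpha fam)
  ((0 : int, 1%N) :: [seq (weightW r i, Mnum fam r i) | r <- ranks fam, i <- [:: 1%N; 2%N]]).
Proof.
move=> w; rewrite card_filter_code big_cons (table_sum _ (k := 1)); last first.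
  by move=> r i; rewrite muln1.
rewrite muln1 /= [LHS](cardsD1 (0 : idx)) inE cw00 wt0.
have -> : #|[set a : idx | (wt (cw a 0%R))%:Z == w] :\ (0 : idx)|
   = #|[set a : idx | (a != 0%R) && (weightW (qrank (Qf a)) (qtype a) == w)]|.
  by apply: eq_card => a; rewrite !inE wt_cw0.
by case: eqP.
Qed.

Lemma wt_constant b : b != 0 -> (wt (cw (0 : idx) b))%:Z = q%:Z ^+ m - 1.
Proof.
move=> b0; rewrite wt_cw b0 PoszX (_ : [set x | _] = set0) ?cards0 ?subr0 //.
apply/setP => x; rewrite !inE lin_poly0 /qform horner0 mulr0 Tr0.
by rewrite eq_sym oppr_eq0 (negPf b0).
Qed.

(** For each R the word with b = 0 has one weight and the q - 1 words with b
    nonzero share another; R = 0 yields the two extra rows. *)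
Lemma code0_weights : weight_distribution (code0 alpha fam)
  ((0 : int, 1%N) :: (q%:Z ^+ m - 1, (q - 1)%N)
    :: [seq (weightW r i, Mnum fam r i) | r <- ranks fam, i <- [:: 1%N; 2%N]]
    ++ [seq (weightW0 r i, (Mnum fam r i * (q - 1))%N)
         | r <- ranks fam, i <- [:: 1%N; 2%N]]).
Proof.
move=> w; rewrite card_filter_code0 !big_cons big_cat.
rewrite (table_sum _ (k := 1)); last by move=> r i; rewrite muln1.
rewrite (table_sum _ (k := q - 1)) // muln1 /=.
set N1 := #|[set a : idx | _ && (weightW _ _ == _)]|.
set N2 := #|[set a : idx | _ && (weightW0 _ _ == _)]|.
have qF : #|[pred b : F | b != 0]| = (q - 1)%N.
  by rewrite subn1 -(cardC1 (0 : F)); apply: eq_card.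
have -> : #|[set t : idx * F | (wt (cw t.1 t.2))%:Z == w]| =
  (\sum_(a : idx) (((wt (cw a 0%R))%:Z == w) + ((wt (cw a 1%R))%:Z == w) * (q - 1)))%N.
  rewrite -sum1_card big_mkcond /=.
  rewrite (eq_bigr (fun t : idx * F => ((wt (cw t.1 t.2))%:Z == w) : nat)) => [|t _]; last first.
    by rewrite inE; case: eqP.
  rewrite -(pair_bigA _ (fun a b => ((wt (cw a b))%:Z == w) : nat)) /=.
  apply: eq_bigr => a _; rewrite (bigD1 0) //=; congr addn.
  rewrite (eq_bigr (fun=> ((wt (cw a 1%R))%:Z == w) : nat)) => [|b b0].
    by rewrite sum_nat_const mulnC qF.
  by rewrite !wt_cw_neq0 // oner_neq0.
rewrite (bigD1 (0 : idx)) //= cw00 wt0 wt_constant ?oner_neq0 // big_split /=.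
have -> : (\sum_(a : idx | a != 0%R) ((wt (cw a 0%R))%:Z == w) = N1)%N.
  rewrite /N1 -sum1_card [RHS]big_mkcond [LHS]big_mkcond /=.
  by apply: eq_bigr => a _; rewrite inE wt_cw0; case: (a != 0); case: eqP.
have -> : (\sum_(a : idx | a != 0%R) ((wt (cw a 1%R))%:Z == w) * (q - 1) = N2 * (q - 1))%N.
  rewrite -big_distrl /=; congr muln.
  rewrite /N2 -sum1_card [RHS]big_mkcond [LHS]big_mkcond /=.
  by apply: eq_bigr => a _; rewrite inE wt_cw_neq0 ?oner_neq0 //; case: (a != 0); case: eqP.
by case: (0 == w); case: (_ == w); rewrite ?mul1n ?mul0n -?addnA ?add0n.
Qed.

End Codewords.

Unset Implicit Arguments.
Set Strict Implicit.

Theorem theorem3p3 (F : finFieldType) (L : splittingFieldType F)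
    (q m : nat) (hq : #|F| = q) (hm : \dim {:L} = m)
    (s : nat) (ell : 'I_s -> nat)
    (ell_ge1 : forall i : 'I_s, (1 <= ell i)%N)
    (ell_incr : forall i j : 'I_s, (i < j)%N -> (ell i < ell j)%N)
    (ell_lt : forall i : 'I_s, (2 * ell i < m)%N)
    (alpha : L) (alpha_prim : (q ^ m - 1)%N.-primitive_root alpha)
    (even_fam : even_rank_family (lin_family L ell)) :
  let fam := lin_family L ell in
  let C := code alpha fam in
  let C0 := code0 alpha fam in
  let W (r i : nat) : int :=
    q%:Z ^+ m - q%:Z ^+ (m - 1)
      + (-1) ^+ i * (q%:Z - 1) * q%:Z ^+ (m - r./2 - 1) in
  let W0 (r i : nat) : int :=
    q%:Z ^+ m - q%:Z ^+ (m - 1)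
      + (-1) ^+ i.+1 * q%:Z ^+ (m - r./2 - 1) - 1 in
  [/\ cyclic_code C /\ has_dimension C (m * s)%N,
      cyclic_code C0 /\ has_dimension C0 (m * s + 1)%N,
      weight_distribution C
        ((0 : int, 1%N)
           :: [seq (W r i, Mnum fam r i) | r <- ranks fam, i <- [:: 1%N; 2%N]])
    & weight_distribution C0
        ((0 : int, 1%N)
           :: (q%:Z ^+ m - 1, (q - 1)%N)
           :: [seq (W r i, Mnum fam r i) | r <- ranks fam, i <- [:: 1%N; 2%N]]
           ++ [seq (W0 r i, (Mnum fam r i * (q - 1))%N)
                 | r <- ranks fam, i <- [:: 1%N; 2%N]])].
Proof.
have ell_inj := increasing_inj ell_incr.
subst q m; move=> fam C C0 W W0.
split; last exact: code0_weights.
- split; first exact: code_cyclic.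
  exact: code_dimension.
- split; first exact: code0_cyclic.
  exact: code0_dimension.
- exact: code_weights.
Qed.
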